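(* Let $\bar A=(A_0,A_1)$ be a compatible couple of (quasi-)Banach spaces with $A_0\cap A_1\neq\{0\}$. Let $0<\theta,\theta_0<1$, $0<q_0,r_0,r_1,r\le\infty$, $a,a_0,b_0,b_1\in SV$, $\left\|s^{-1/r_0}\frac{b_0(s)}{a_0(s)}\right\|_{r_0,(1,\infty)}<\infty$, and $\left\|s^{-1/r_1}b_1(s)\right\|_{r_1,(0,1)}<\infty$. Put $c_0(t)=a_0(t)\left\|s^{-1/r_0}\frac{b_0(s)}{a_0(s)}\right\|_{r_0,(t,\infty)}$, $c_1(t)=\left\|s^{-1/r_1}b_1(s)\right\|_{r_1,(0,t)}$, and $\rho(t)=t^{1-\theta_0}\frac{c_0(t)}{c_1(t)}$ for $t>0$. Then $$\left(\bar A^{\mathcal L}_{\theta_0,r_0,b_0,q_0,a_0},\bar A_{1,r_1,b_1}\right)_{\theta,r,a}\cong\bar A_{\eta,r,a^{\#}},$$ where $\eta=(1-\theta)\theta_0+\theta$ and $a^{\#}(t)=c_0(t)^{1-\theta}c_1(t)^{\theta}a(\rho(t))$.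
   Context: For a compatible couple $\bar X=(X_0,X_1)$ of (quasi-)Banach spaces, $f\in X_0+X_1$ and $t>0$, $K(t,f)=K(t,f;\bar X)=\inf\{\|f_0\|_{X_0}+t\|f_1\|_{X_1}: f=f_0+f_1,\ f_i\in X_i\}$. $\|\cdot\|_{q,(c,d)}$ ($0<q\le\infty$) is the usual (quasi-)norm of the Lebesgue space $L_q$ on the interval $(c,d)$ with Lebesgue measure (variable of integration: the displayed variable; $1/\infty=0$). $SV$ is the set of positive Lebesgue measurable functions $b$ on $(0,\infty)$ that are slowly varying: for each $\varepsilon>0$, $t^{\varepsilon}b(t)$ is equivalent to an increasing function and $t^{-\varepsilon}b(t)$ is equivalent to a decreasing function, where two positive functions are equivalent if each is bounded by a constant multiple of the other. For $0\le\theta\le1$, $0<q\le\infty$, $b\in SV$, $\bar X_{\theta,q,b}=(X_0,X_1)_{\theta,q,b}$ is the space of $f\in X_0+X_1$ with $\|f\|=\left\|u^{-\theta-1/q}b(u)K(u,f)\right\|_{q,(0,\infty)}<\infty$. For $0<\sigma<1$, $0<r,q\le\infty$, $a,b\in SV$, $\bar X^{\mathcal L}_{\sigma,r,b,q,a}$ is the space of $f\in X_0+X_1$ with $\|f\|=\left\|t^{-1/r}\frac{b(t)}{a(t)}\left\|u^{-\sigma-1/q}a(u)K(u,f)\right\|_{q,(0,t)}\right\|_{r,(0,\infty)}<\infty$. $X\cong Y$ means that $X$ and $Y$ are continuously embedded in each other (same space, equivalent quasi-norms). *)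

(* Defs.v *)
(* MathComp-Analysis; the reals are an abstract [R : realType]. *)
From HB Require Import structures.
From mathcomp Require Export all_boot all_order all_algebra.
From mathcomp Require Export all_classical all_reals all_analysis.

Set Implicit Arguments.
Unset Strict Implicit.
Unset Printing Implicit Defensive.

Import Order.TTheory GRing.Theory Num.Theory.
Import numFieldNormedType.Exports.

Local Open Scope classical_set_scope.
Local Open Scope ring_scope.

Section Lebesgue.
Context {R : realType}.

(* The real line with its Lebesgue (Caratheodory) sigma-algebra; the library's
   canonical one on [R] is the Borel sigma-algebra. *)
Local Notation lebT :=
  (caratheodory_type ((wlength (idfun : R -> R))^*)%mu).

Definition leb : {measure set lebT -> \bar R} := @completed_lebesgue_measure R.

(* The norm of L_q(D), q in ]0, +oo].  When |f| is not Lebesgue measurable,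
   the integral is the lower integral. *)
Definition Lq (q : \bar R) (D : set R) (f : R -> \bar R) : \bar R :=
  'N[leb]_q[(f \_ D : lebT -> \bar R)].

(* 1/q, with 1/oo = 0 *)
Definition recip (q : \bar R) : R := fine (q^-1)%E.

Definition equivf (f g : R -> R) : Prop :=
  exists2 C : R, 0 < C & forall t, 0 < t -> f t <= C * g t /\ g t <= C * f t.

Definition SV (b : R -> R) : Prop :=
  [/\ forall t, 0 < t -> 0 < b t,
      measurable_fun (`]0, +oo[ : set lebT) (b : lebT -> measurableTypeR R)
    & forall e, 0 < e ->
      (exists g : R -> R,
        [/\ forall t, 0 < t -> 0 < g t,
            forall s t, 0 < s -> s <= t -> g s <= g t
          & equivf (fun t => t `^ e * b t) g]) /\
      (exists h : R -> R,
        [/\ forall t, 0 < t -> 0 < h t,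
            forall s t, 0 < s -> s <= t -> h t <= h s
          & equivf (fun t => t `^ (- e) * b t) h])].

End Lebesgue.

Section Couples.
Context {R : realType}.

(* A linear space of elements of an ambient vector space V, with its
   (quasi-)norm: only the values of [qnorm] on [carrier] are meaningful. *)
Record qspace (V : Type) := QSpace {
  carrier : set V ;
  qnorm : V -> \bar R }.

Definition quasi_banach (V : lmodType R) (X : qspace V) : Prop :=
  [/\ carrier X 0 /\ (forall (c : R) f g,
        carrier X f -> carrier X g -> carrier X (c *: f + g)),
      forall f, carrier X f ->
        (0 <= qnorm X f < +oo)%E /\ (qnorm X f = 0%E -> f = 0),
      forall (c : R) f, carrier X f ->
        qnorm X (c *: f) = (`|c|%:E * qnorm X f)%E,
      exists C : R, forall f g, carrier X f -> carrier X g ->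
        (qnorm X (f + g)%R <= C%:E * (qnorm X f + qnorm X g))%E
    & forall u : nat -> V, (forall n, carrier X (u n)) ->
        (forall e : R, 0 < e -> exists N : nat, forall m n : nat,
           (N <= m)%N -> (N <= n)%N -> (qnorm X (u m - u n)%R < e%:E)%E) ->
        exists2 l : V, carrier X l &
          forall e : R, 0 < e -> exists N : nat, forall n : nat,
            (N <= n)%N -> (qnorm X (u n - l)%R < e%:E)%E].

(* Continuity at 0 of the (linear) inclusion of X into V. *)
Definition cts_included (V : topologicalLmodType R) (X : qspace V) : Prop :=
  forall U : set V, nbhs 0 U ->
    exists2 d : R, 0 < d &
      forall f, carrier X f -> (qnorm X f < d%:E)%E -> U f.

Definition compatible_couple (V : topologicalLmodType R) (X0 X1 : qspace V) :
    Prop :=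
  [/\ hausdorff_space V, quasi_banach X0, quasi_banach X1, cts_included X0
    & cts_included X1].

Section Interpolation.
Context {V : lmodType R}.
Implicit Types X Y : qspace V.

Definition sum_space X0 X1 : set V :=
  [set f0 + f1 | f0 in carrier X0 & f1 in carrier X1].

Definition Kfun X0 X1 (t : R) (f : V) : \bar R :=
  ereal_inf [set x : \bar R | exists f0 f1,
    [/\ carrier X0 f0, carrier X1 f1, f = f0 + f1
      & x = (qnorm X0 f0 + t%:E * qnorm X1 f1)%E]].

Definition interpK_norm X0 X1 (theta : R) (q : \bar R) (b : R -> R) (f : V) :
    \bar R :=
  Lq q `]0, +oo[
    (fun u => (u `^ (- theta - recip q) * b u)%:E * Kfun X0 X1 u f)%E.

(* (X0, X1)_{theta, q, b} *)
Definition interpK X0 X1 theta q b : qspace V :=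
  QSpace [set f | sum_space X0 X1 f /\
                  (interpK_norm X0 X1 theta q b f < +oo)%E]
         (interpK_norm X0 X1 theta q b).

Definition interpL_norm X0 X1 (sigma : R) (r : \bar R) (b : R -> R)
    (q : \bar R) (a : R -> R) (f : V) : \bar R :=
  Lq r `]0, +oo[
    (fun t => (t `^ (- recip r) * (b t / a t))%:E *
       Lq q `]0%R, t[
         (fun u => (u `^ (- sigma - recip q) * a u)%:E * Kfun X0 X1 u f))%E.

(* (X0, X1)^L_{sigma, r, b, q, a} *)
Definition interpL X0 X1 sigma r b q a : qspace V :=
  QSpace [set f | sum_space X0 X1 f /\
                  (interpL_norm X0 X1 sigma r b q a f < +oo)%E]
         (interpL_norm X0 X1 sigma r b q a).

Definition embedded X Y : Prop :=
  (carrier X `<=` carrier Y)%classic /\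
  exists2 C : R, 0 < C &
    forall f, carrier X f -> (qnorm Y f <= C%:E * qnorm X f)%E.

Definition same_space X Y : Prop := embedded X Y /\ embedded Y X.

End Interpolation.
End Couples.

(* Main.v *)
(* Discretising along the intervals [e^k, e^(k+1)) and writing everything in the
   variable [ln t], a slowly varying function grows at most like
   [exp (eps * |ln s - ln t|)], up to a constant, for every eps > 0.

   Write K_Y for the K-functional of the couple Y0 = A^L_{theta0,r0,b0,q0,a0},
   Y1 = A_{1,r1,b1}, and K for that of (A0, A1).  Restricting the norms of Y0 and
   Y1 to (t, oo) and (0, t) gives
     K(t, f0) <= C (t^theta0 / c0(t)) |f0|_Y0,  K(t, f1) <= C (t / c1(t)) |f1|_Y1,
   hence c0(t) t^(-theta0) K(t, f) <= C K_Y(rho(t), f), which is one embedding.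
   Conversely, suppose that
     phi(u) := u^(-eta) a#(u) K(u, f) <= B exp (delta * |ln u - ln t|)  for all u,
   with delta small.  A near-optimal splitting of f at t inherits this growth,
   and bounding all inner integrands by two-sided exponential peaks yields
   rho(t)^(-theta) a(rho(t)) K_Y(rho(t), f) <= C B: a pointwise estimate, valid
   for all exponents including the quasi-Banach range.  Both embeddings then
   follow from one discrete inequality in L_r(dt/t), [Lq_transfer], which
   plays the role of Hardy's inequality and of the change of variables u = rho(t). *)
Require Import Defs.
From mathcomp Require Import all_boot all_order all_algebra.
From mathcomp Require Import all_classical all_reals all_analysis.
From mathcomp Require Import measurable_realfun ess_sup_inf ring lra.
Import Order.TTheory GRing.Theory Num.Theory.
Import numFieldNormedType.Exports.
Local Open Scope classical_set_scope.
Local Open Scope ring_scope.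

Set Implicit Arguments.
Unset Strict Implicit.

(** * Norms of restricted functions *)

(** Two obstacles shape the argument. [Lq] of a function not known to be measurable is a lower
    integral, which is monotone but not additive, and no measurability is established for the inner
    norm of [interpL] or for the K-functional of the new couple. So norms are split only after
    passing to an explicit measurable majorant (a weight or an exponential peak), lower bounds come
    from constants on an interval of logarithmic length 1, and [moderate] functions are compared
    with step functions. Moreover [rho] need be neither monotone nor continuous, because a0 may
    jump. What survives is that ln rho, as a function of ln t, stays near the line of slope 1 -
    theta0 with a small relative error; this gives separation of its values and a quasi-inverse,
    enough to sum over e-adic points. The growth exp(delta * |ln u - ln t|) in the pointwise
    estimate is the source of summability: a supremum against the decaying weight is dominated by an
    l_q sum, whose q-th power is additive for every finite q, so convexity never enters. The delta
    used must keep eta - 2 delta above theta0 and eta + 2 delta below 1. *)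

Section LnormBasics.
Context {d} {T : measurableType d} {R : realType}.
Variable mu : {measure set T -> \bar R}.
Hypothesis muT : (0 < mu [set: T])%E.
Local Open Scope ereal_scope.
Implicit Types (q : \bar R) (D E : set T) (F G : T -> \bar R).

(** Both sides are suprema over the simple functions lying below, so no measurability is
    involved. *)
Lemma ge0_le_integral_nonmeas F G :
  (forall x, 0 <= F x) -> (forall x, F x <= G x) ->
  \int[mu]_x F x <= \int[mu]_x G x.
Proof.
move=> F0 FG; have G0 x : 0 <= G x := le_trans (F0 x) (FG x).
rewrite !ge0_integralTE//; apply: ge_ereal_sup => _ [h /= hF <-].
by apply: ereal_sup_ubound; exists h => // x; exact: le_trans (hF x) (FG x).
Qed.

Lemma LnormE (q : R) F : 'N[mu]_q%:E[F] = (\int[mu]_x (`|F x| `^ q)) `^ q^-1.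
Proof. by rewrite unlock. Qed.

Lemma LnormyE F : 'N[mu]_+oo[F] = ess_sup mu (fun x => `|F x|).
Proof. by rewrite unlock muT. Qed.

Lemma ge0_le_poweR (r : R) (x y : \bar R) : (0 <= r)%R -> 0 <= x -> x <= y ->
  x `^ r <= y `^ r.
Proof.
move=> r0 x0 xy; apply: gt0_ler_poweR => //; rewrite in_itv/= leey andbT//.
exact: le_trans xy.
Qed.

Lemma le_Lnorm_patch q D E F G : 0 < q ->
  (forall x, D x -> 0 <= F x) -> (forall x, E x -> 0 <= G x) ->
  (forall x, D x -> E x /\ F x <= G x) ->
  'N[mu]_q[F \_ D] <= 'N[mu]_q[G \_ E].
Proof.
move=> q0 F0 G0 FG.
have h x : `|(F \_ D) x| <= `|(G \_ E) x|.
  rewrite /patch; case: ifPn => [/[!inE] Dx|_]; last by rewrite abse0 abse_ge0.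
  have [Ex FGx] := FG _ Dx.
  by rewrite mem_set// !gee0_abs//; [exact: G0|exact: F0].
case: q q0 => [q|_|//].
  rewrite lte_fin => q0; rewrite !LnormE.
  apply: ge0_le_poweR; first by rewrite invr_ge0 ltW.
    by apply: integral_ge0 => x _; exact: poweR_ge0.
  apply: ge0_le_integral_nonmeas => x; first exact: poweR_ge0.
  by apply: ge0_le_poweR (h x); [exact: ltW|exact: abse_ge0].
by rewrite !LnormyE; apply: le_ess_sup; exact: nearW.
Qed.

Let measurable_pow_patch (q : R) D F : measurable D -> measurable_fun D F ->
  measurable_fun [set: T] (fun x => `|(F \_ D) x| `^ q).
Proof.
move=> mD mF; apply: (measurableT_comp (measurable_poweR q)).
by apply: measurableT_comp => //; apply/(measurable_restrictT _ _).1.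
Qed.

Lemma Lnorm_patch_scale q D F (c : R) : 0 < q -> measurable D ->
  measurable_fun D F -> (0 <= c)%R ->
  'N[mu]_q[(fun x => c%:E * F x) \_ D] = c%:E * 'N[mu]_q[F \_ D].
Proof.
move=> q0 mD mF c0.
have h x : `|((fun x => c%:E * F x) \_ D) x| = c%:E * `|(F \_ D) x|.
  rewrite /patch; case: ifPn => [/[!inE] Dx|_]; last by rewrite abse0 mule0.
  by rewrite abseM /= ger0_norm.
case: q q0 => [q|_|//].
  rewrite lte_fin => q0; rewrite !LnormE.
  under eq_integral => x _ do rewrite h poweRM// poweR_EFin.
  rewrite ge0_integralZl_EFin ?powR_ge0//; first last.
  - exact: measurable_pow_patch.
  - by move=> x _; exact: poweR_ge0.
  rewrite poweRM ?lee_fin ?powR_ge0//; last first.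
    by apply: integral_ge0 => x _; exact: poweR_ge0.
  by rewrite poweR_EFin -powRrM mulfV ?gt_eqF// powRr1.
rewrite !LnormyE; under eq_fun do rewrite h.
exact: (ess_supZl _ muT c0).
Qed.

(** A quasi-triangle inequality for every q. Only the majorants need be measurable, since additivity
    of the integral is applied to them alone. For finite q the constant [2 ^ (1/q)] comes from I1 +
    I2 <= 2 max(I1, I2); for q = oo it is 1. *)
Lemma Lnorm_patch_split q : 0 < q -> exists2 C : R, (0 < C)%R &
  forall D D1 D2 F F1 F2,
    measurable D1 -> measurable D2 ->
    measurable_fun D1 F1 -> measurable_fun D2 F2 ->
    (forall x, D x -> 0 <= F x) ->
    (forall x, D x -> (D1 x /\ F x <= F1 x) \/ (D2 x /\ F x <= F2 x)) ->
    'N[mu]_q[F \_ D] <= C%:E * ('N[mu]_q[F1 \_ D1] + 'N[mu]_q[F2 \_ D2]).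
Proof.
move=> q0.
have h D D1 D2 F F1 F2 :
    (forall x, D x -> 0 <= F x) ->
    (forall x, D x -> (D1 x /\ F x <= F1 x) \/ (D2 x /\ F x <= F2 x)) ->
    forall x, [\/ `|(F \_ D) x| = 0, `|(F \_ D) x| <= `|(F1 \_ D1) x|
      | `|(F \_ D) x| <= `|(F2 \_ D2) x| ].
  move=> F0 h x; rewrite {1 2 4}/patch.
  case: ifPn => [/[!inE] Dx|_]; last by constructor 1; rewrite abse0.
  rewrite gee0_abs ?F0//; have [[D1x le1]|[D2x le2]] := h _ Dx.
    by constructor 2; rewrite (le_trans le1)// (le_trans (lee_abs _))// /patch mem_set.
  by constructor 3; rewrite (le_trans le2)// (le_trans (lee_abs _))// /patch mem_set.
case: q q0 => [q|_|//]; last first.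
  exists 1%R => // D D1 D2 F F1 F2 mD1 mD2 mF1 mF2 F0 hF.
  rewrite mul1e !LnormyE; apply: le_trans (ess_supD _ _ _); apply: le_ess_sup.
  apply: nearW => x /=; case: (h _ _ _ _ _ _ F0 hF x) => [->|/le_trans|/le_trans].
  - by rewrite adde_ge0.
  - by apply; rewrite leeDl.
  - by apply; rewrite leeDr.
rewrite lte_fin => q0; exists (2 `^ q^-1)%R; first exact: powR_gt0.
move=> D D1 D2 F F1 F2 mD1 mD2 mF1 mF2 F0 hF.
have q'0 : (0 <= q^-1)%R by rewrite invr_ge0 ltW.
have I0 G E : 0 <= \int[mu]_x (`|(G \_ E) x| `^ q).
  by apply: integral_ge0 => x _; exact: poweR_ge0.
rewrite !LnormE.
set I1 := \int[mu]_x (`|(F1 \_ D1) x| `^ q).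
set I2 := \int[mu]_x (`|(F2 \_ D2) x| `^ q).
have le12 : \int[mu]_x (`|(F \_ D) x| `^ q) <= I1 + I2.
  rewrite -ge0_integralD//; try exact: measurable_pow_patch;
    try by move=> x _; exact: poweR_ge0.
  apply: ge0_le_integral_nonmeas => x; first exact: poweR_ge0.
  case: (h _ _ _ _ _ _ F0 hF x) => [->|le1|le2].
  - by rewrite poweR0r ?gt_eqF// adde_ge0 ?poweR_ge0.
  - apply: le_trans (leeDl _ (poweR_ge0 _ _)).
    by apply: ge0_le_poweR => //; exact: ltW.
  - apply: le_trans (leeDr _ (poweR_ge0 _ _)).
    by apply: ge0_le_poweR => //; exact: ltW.
have I10 : 0 <= I1 by exact: I0.
have I20 : 0 <= I2 by exact: I0.
apply: (le_trans (ge0_le_poweR _ (I0 _ _) le12)) => //.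
rewrite -poweR_EFin ge0_muleDr ?poweR_ge0// -!poweRM//.
have [I12|I21] := leP I1 I2.
  apply: le_trans (leeDr _ (poweR_ge0 _ _)).
  apply: ge0_le_poweR => //; first exact: adde_ge0.
  by rewrite mule_natl mule2n leeD2r.
apply: le_trans (leeDl _ (poweR_ge0 _ _)).
apply: ge0_le_poweR => //; first exact: adde_ge0.
by rewrite mule_natl mule2n leeD2l// ltW.
Qed.

End LnormBasics.

(** * Exponential sums over the integers *)

Section IntegerSums.
Context {R : realType}.

(** The enumeration 0, -1, 1, -2, ... of the integers, through which sums over all e-adic intervals
    become series over nat. *)
Definition int_of_nat (n : nat) : int := if odd n then Negz n./2 else Posz n./2.

Definition nat_of_int (k : int) : nat :=
  match k with Posz m => m.*2 | Negz m => m.*2.+1 end.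

Lemma int_of_natK : cancel int_of_nat nat_of_int.
Proof.
move=> n; rewrite /int_of_nat; have := odd_double_half n.
by case: (odd n) => /=; rewrite ?add1n ?add0n.
Qed.

Lemma nat_of_intK : cancel nat_of_int int_of_nat.
Proof.
by case=> m; rewrite /int_of_nat /= odd_double /= ?uphalf_double ?doubleK.
Qed.

Lemma int_of_nat_lower (n : nat) : n%:R / 2 <= `|(int_of_nat n)%:~R| :> R.
Proof.
rewrite /int_of_nat -{1}(odd_double_half n) -muln2 natrD natrM.
have h0 : 0 <= n./2%:R :> R by [].
case: (odd n) => /=; last first.
  by rewrite ger0_norm//; lra.
rewrite NegzE mulrNz normrN -pmulrn ger0_norm// -natr1; lra.
Qed.

Lemma nneseries_le (u : nat -> R) (C : R) : (forall n, 0 <= u n) ->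
  (forall n, \sum_(i < n) u i <= C) -> (\sum_(n <oo) (u n)%:E <= C%:E)%E.
Proof.
move=> u0 uC; apply: lime_le; first by apply: is_cvg_nneseries => n _ _; rewrite lee_fin.
by apply: nearW => n; rewrite sumEFin lee_fin big_mkord.
Qed.

Lemma le_term_nneseries (u : nat -> \bar R) m : (forall n, 0 <= u n)%E ->
  (u m <= \sum_(n <oo) u n)%E.
Proof.
move=> u0; apply: le_trans (nneseries_lim_ge m.+1 _) => //.
by rewrite big_nat_recr//= leeDr// sume_ge0.
Qed.

(** Uniformity in k0 is the point: a shift of the integers permutes the terms of the series. At k0 =
    0 the n-th term is at most [r ^ n] with r = exp(-e/2), by [int_of_nat_lower]. *)
Lemma int_series_expR (e : R) : 0 < e -> exists2 C : R, 0 < C &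
  forall k0 : int,
    (\sum_(n <oo) (expR (- (e * `|(int_of_nat n + k0)%:~R|)))%:E <= C%:E)%E.
Proof.
move=> e0; pose r := expR (- (e / 2)).
have r0 : 0 < r by exact: expR_gt0.
have r1 : r < 1 by rewrite /r expR_lt1; lra.
exists (1 - r)^-1; first by rewrite invr_gt0 subr_gt0.
move=> k0.
have -> : (\sum_(n <oo) (expR (- (e * `|(int_of_nat n + k0)%:~R|)))%:E =
           \sum_(n <oo) (expR (- (e * `|(int_of_nat n)%:~R|)))%:E)%E.
  rewrite !nneseries_esumT; [|by move=> n; rewrite lee_fin expR_ge0..].
  rewrite (@reindex_esum R nat nat setT setT (fun n => nat_of_int (int_of_nat n + k0))
     (fun n => (expR (- (e * `|(int_of_nat n)%:~R|)))%:E)).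
    by apply: eq_esum => n _; rewrite nat_of_intK.
  split => //=.
    move=> x y _ _ /(can_inj nat_of_intK) /addIr; exact: (can_inj int_of_natK).
  move=> y _ /=; exists (nat_of_int (int_of_nat y - k0)) => //.
  by rewrite nat_of_intK subrK int_of_natK.
apply: nneseries_le => [n|n]; first exact: expR_ge0.
apply: (@le_trans _ _ (\sum_(i < n) r ^+ i)).
  apply: ler_sum => i _; rewrite /r -expRM_natl ler_expR.
  have := int_of_nat_lower i; nra.
rewrite -[leRHS]mul1r ler_pdivlMr ?subr_gt0// mulrC.
by rewrite -(opprB r) mulNr -subrX1 opprB gerBl exprn_ge0// ltW.
Qed.

(* Choosing [k0] with [x k0] nearly closest to [y] reduces the sum to a
   geometric series centred at [k0]. *)
Lemma separated_series_expR (e kappa c : R) : 0 < e -> 0 < kappa ->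
  exists2 C : R, 0 < C & forall (x : int -> R) (y : R),
    (forall k l : int, kappa * `|k%:~R - l%:~R| - c <= `|x k - x l|) ->
    (\sum_(n <oo) (expR (- (e * `|y - x (int_of_nat n)|)))%:E <= C%:E)%E.
Proof.
move=> e0 kap0.
have [C C0 HC] := @int_series_expR (e * kappa / 2) (divr_gt0 (mulr_gt0 e0 kap0) (ltr0Sn R 1)).
exists (expR (e * (c + 1) / 2) * C); first by rewrite mulr_gt0// expR_gt0.
move=> x y sep.
(* With such a k0, |x k - x k0| <= |y - x k| + |y - x k0| <= 2 |y - x k| + 1. This is why half of e
   * kappa remains as decay rate and c + 1 enters the constant. *)
have [k0 Hk0] : exists k0 : int, forall k, `|y - x k0| <= `|y - x k| + 1.
  pose S := [set `|y - x k| | k in [set: int]].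
  have hS : has_inf S by split; [exists `|y - x 0|, 0|exists 0 => _ [k _ <-]].
  have [_ [k0 _ <-] lt0] := inf_adherent ltr01 hS.
  exists k0 => k; apply: (le_trans (ltW lt0)); rewrite lerD2r.
  by apply: ge_inf; [exact: hS.2|exists k].
rewrite EFinM; apply: le_trans (lee_wpmul2l _ (HC (- k0))); last first.
  by rewrite lee_fin expR_ge0.
rewrite -nneseriesZl; last by move=> n _; rewrite lee_fin expR_ge0.
apply: lee_nneseries => [n _ _|n _]; first by rewrite lee_fin expR_ge0.
rewrite -EFinM -expRD lee_fin ler_expR.
set k := int_of_nat n; have := sep k k0; have := Hk0 k.
have := ler_distD y (x k) (x k0); rewrite (distrC (x k) y) intrB.
set A := `|_ - x k0|; set B := `|y - x k|; set D := `|_%:~R - _|.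
set E := `|x k - x k0| => h1 h2 h3.
have : kappa * D - c - 1 <= 2 * B by lra.
move=> h4; suff : e * (kappa * D - c - 1) <= e * (2 * B) by lra.
by rewrite ler_pM2l.
Qed.

End IntegerSums.

(** * Discretisation of the L_q norm *)

Lemma integral_partition d (T : measurableType d) (R : realType)
    (mu : {measure set T -> \bar R}) (D : set T) (idx : T -> nat)
    (g : nat -> \bar R) :
  (forall n, measurable (D `&` [set x | idx x = n])) ->
  (forall n, 0 <= g n)%E ->
  (\int[mu]_(x in D) g (idx x) =
   \sum_(n <oo) g n * mu (D `&` [set x | idx x = n]))%E.
Proof.
move=> mD g0; pose I n := D `&` [set x | idx x = n].
have DE : D = \bigcup_n I n.
  by apply/seteqP; split => [x Dx|x [n _ []]//]; exists (idx x).
have gI n x : I n x -> g (idx x) = g n by case=> _ ->.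
rewrite {1}DE ge0_integral_bigcup//.
- apply: eq_eseriesr => n _; rewrite -(integral_cst mu (mD n)).
  by apply: eq_integral => x /[!inE] /gI ->.
- apply/measurable_fun_bigcup => // n.
  apply: (eq_measurable_fun (cst (g n))) => [x /[!inE] /gI ->//|].
  exact: measurable_cst.
- by move=> i j _ _ [x [[_ <-] [_ <-]]].
Qed.

(** On an interval of bounded logarithmic length such a function is constant up to a factor, so its
    values at the points e^k determine its weighted norm up to constants. The 1 in the exponent
    absorbs multiplicative constants. *)
Definition moderate {R : realType} (N : R) (phi : R -> R) :=
  forall u v : R, 0 < u -> 0 < v ->
    phi u <= phi v * expR (N * (1 + `|ln u - ln v|)).

Section Discretization.
Context {R : realType}.

Local Notation lebT :=
  (caratheodory_type ((wlength (idfun : R -> R))^*)%mu).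
Local Notation pos := (`]0, +oo[%classic : set R).

Lemma measurable_leb (A : set R) :
  measurable (A : set (measurableTypeR R)) -> measurable (A : set lebT).
Proof. by move=> mA; exact: sub_caratheodory. Qed.

Lemma leb_itv (i : interval R) :
  leb [set` i] = (if (i.1 < i.2)%E then (i.2 - i.1)%E else 0).
Proof. exact: (lebesgue_measure_itv i). Qed.

Lemma leb_setT_gt0 : (0 < leb [set: R])%E.
Proof. by rewrite -(set_itvNyy R) leb_itv /= ltry. Qed.

Definition eadic (u : R) : nat := nat_of_int (Num.floor (ln u)).

Lemma eadic_itv n : pos `&` [set u | eadic u = n] =
  `[expR (int_of_nat n)%:~R, expR ((int_of_nat n)%:~R + 1)[%classic.
Proof.
apply/seteqP; split => u /=; rewrite !in_itv/= andbT.
  case=> u0 <-; rewrite /eadic nat_of_intK -{2 3}(lnK u0).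
  have := floor_itv (ln u); rewrite intrD1 => /andP[h1 h2].
  by rewrite ler_expR ltr_expR h1.
move=> /andP[h1 h2]; have u0 : 0 < u by apply: lt_le_trans h1; exact: expR_gt0.
split => //; rewrite /eadic -[RHS]int_of_natK; congr nat_of_int.
move: h1 h2; rewrite -{1 2}(lnK u0) ler_expR ltr_expR => h1 h2.
by apply: floor_def; rewrite intrD1 h1.
Qed.

Lemma measurable_eadic n : measurable (pos `&` [set u | eadic u = n] : set lebT).
Proof. by rewrite eadic_itv; apply: measurable_leb; exact: measurable_itv. Qed.

Lemma leb_eadic n : leb (pos `&` [set u | eadic u = n]) =
  (expR (int_of_nat n)%:~R * (expR 1 - 1))%:E.
Proof.
rewrite eadic_itv leb_itv /= lte_fin ltr_expR ltrDl ltr01.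
by rewrite -EFinB expRD mulrBr mulr1.
Qed.

Lemma eadicP u : 0 < u ->
  (int_of_nat (eadic u))%:~R <= ln u < (int_of_nat (eadic u))%:~R + 1.
Proof.
move=> u0; rewrite /eadic nat_of_intK.
by have := floor_itv (ln u); rewrite intrD1.
Qed.

(** The factor e^(-k) cancels the length e^k (e - 1) of the k-th interval. *)
Lemma integral_eadic (g : nat -> R) : (forall n, 0 <= g n) ->
  (\int[leb]_(u in (pos : set lebT)) (expR (- (int_of_nat (eadic u))%:~R) * g (eadic u))%:E =
   (expR 1 - 1)%:E * \sum_(n <oo) (g n)%:E)%E.
Proof.
move=> g0.
rewrite (@integral_partition _ lebT R leb (pos : set lebT) eadic
   (fun n => (expR (- (int_of_nat n)%:~R) * g n)%:E)).
- rewrite -nneseriesZl; last by move=> n _; rewrite lee_fin.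
  apply: eq_eseriesr => n _; rewrite [X in (_ * X)%E](leb_eadic n) -!EFinM.
  congr EFin; set x := (int_of_nat n)%:~R; set e := expR 1 - 1.
  have -> : expR (- x) * g n * (expR x * e) = expR x * expR (- x) * (e * g n).
    by ring.
  by rewrite expRxMexpNx_1 mul1r.
- exact: measurable_eadic.
- by move=> n; rewrite lee_fin mulr_ge0 ?expR_ge0.
Qed.


End Discretization.

(** * Weighted L_q norms against series, peaks and constants *)

Section LqEstimates.
Context {R : realType}.

Local Notation lebT :=
  (caratheodory_type ((wlength (idfun : R -> R))^*)%mu).
Local Notation pos := (`]0, +oo[%classic : set R).

Lemma powRE (u p : R) : 0 < u -> u `^ p = expR (p * ln u).
Proof. by move=> u0; rewrite /powR gt_eqF. Qed.

Lemma le_Lq (q : \bar R) (D E : set R) F G : (0 < q)%E ->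
  (forall x, D x -> 0 <= F x)%E -> (forall x, E x -> 0 <= G x)%E ->
  (forall x, D x -> E x /\ F x <= G x)%E ->
  (Lq q D F <= Lq q E G)%E.
Proof. exact: (@le_Lnorm_patch _ lebT R leb leb_setT_gt0). Qed.

Lemma Lq_ge0 (q : \bar R) (D : set R) F : (0 <= Lq q D F)%E.
Proof. exact: Lnorm_ge0. Qed.

Lemma recip_fin (q : R) : 0 < q -> recip q%:E = q^-1.
Proof. by move=> q0; rewrite /recip inver gt_eqF. Qed.

Lemma recipy : recip (+oo%E : \bar R) = 0.
Proof. by []. Qed.

(** The weight u^(-1/q) turns Lebesgue measure into du/u; the factor [expR (- ln u)] is 1/u. *)
Lemma Lq_finE (q : R) (phi : R -> R) : 0 < q -> (forall u, 0 < u -> 0 <= phi u) ->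
  Lq q%:E pos (fun u => (u `^ (- recip q%:E) * phi u)%:E) =
  ((\int[leb]_(u in (pos : set lebT)) (expR (- ln u) * phi u `^ q)%:E) `^ q^-1)%E.
Proof.
move=> q0 phi0; rewrite /Lq LnormE [in RHS]integral_mkcond; congr (_ `^ _)%E.
apply: eq_integral => u _; rewrite /patch.
have [Pu|Pu] := pselect (pos u); last by rewrite !memNset// abse0 poweR0r// gt_eqF.
have u0 : 0 < u by move: Pu; rewrite /= in_itv/= andbT.
rewrite !mem_set//.
rewrite gee0_abs ?lee_fin ?mulr_ge0 ?powR_ge0 ?phi0//.
rewrite poweR_EFin powRM ?powR_ge0 ?phi0// -powRrM recip_fin// mulNr mulVf ?gt_eqF//.
by rewrite powRE// mulN1r.
Qed.

Lemma moderate_le N phi u v : 0 <= N -> moderate N phi -> 0 < u -> 0 < v ->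
  0 <= phi v -> `|ln u - ln v| <= 1 -> phi u <= phi v * expR (2 * N) :> R.
Proof.
move=> N0 mphi u0 v0 phi0 h; apply: (le_trans (mphi _ _ u0 v0)).
by rewrite ler_wpM2l// ler_expR; nra.
Qed.

(** The integrand is dominated by a step function on the e-adic intervals: 1/u is at most e^(-k)
    there and phi exceeds phi(e^k) by at most the factor e^(2N). *)
Lemma int_le_series (q N : R) : 0 < q -> 0 <= N -> exists2 C : R, 0 < C &
  forall phi : R -> R, (forall u, 0 < u -> 0 <= phi u) -> moderate N phi ->
    (\int[leb]_(u in (pos : set lebT)) (expR (- ln u) * phi u `^ q)%:E <=
     C%:E * \sum_(n <oo) (phi (expR (int_of_nat n)%:~R) `^ q)%:E)%E.
Proof.
move=> q0 N0; have e1 : 0 < expR 1 - 1 :> R by rewrite subr_gt0 expR_gt1.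
exists ((expR 1 - 1) * expR (2 * N) `^ q).
  by rewrite mulr_gt0// powR_gt0// expR_gt0.
move=> phi phi0 mphi; rewrite EFinM -muleA -nneseriesZl; last first.
  by move=> n _; rewrite lee_fin powR_ge0.
rewrite -integral_eadic; last by move=> n; rewrite mulr_ge0 ?powR_ge0.
rewrite [leLHS]integral_mkcond [leRHS]integral_mkcond.
apply: ge0_le_integral_nonmeas => u; rewrite /patch.
  by case: ifPn => // _; rewrite lee_fin mulr_ge0 ?expR_ge0 ?powR_ge0.
case: ifPn => // /[!inE]/=; rewrite in_itv/= andbT => u0.
have /andP[h1 h2] := eadicP u0; rewrite lee_fin.
rewrite ler_pM ?expR_ge0 ?powR_ge0 ?ler_expR ?lerN2// mulrC -powRM ?expR_ge0 ?phi0 ?expR_gt0//.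
apply: ge0_ler_powR; rewrite ?nnegrE ?mulr_ge0 ?expR_ge0 ?phi0 ?expR_gt0 ?(ltW q0)//.
apply: moderate_le => //; rewrite ?expR_gt0 ?phi0 ?expR_gt0// expRK.
by rewrite ger0_norm; lra.
Qed.

Lemma series_le_int (q N : R) : 0 < q -> 0 <= N -> exists2 C : R, 0 < C &
  forall phi : R -> R, (forall u, 0 < u -> 0 <= phi u) -> moderate N phi ->
    (\sum_(n <oo) (phi (expR (int_of_nat n)%:~R) `^ q)%:E <=
     C%:E * \int[leb]_(u in (pos : set lebT)) (expR (- ln u) * phi u `^ q)%:E)%E.
Proof.
move=> q0 N0; have e1 : 0 < expR 1 - 1 :> R by rewrite subr_gt0 expR_gt1.
(* On the interval [e^k, e^(k+1)) one has 1/u >= e^(-k-1), whence [expR (-1)], and phi(u) >= e^(-2N)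
   phi(e^k). *)
pose c : R := expR (-1) * expR (- (2 * N)) `^ q.
have c0 : 0 < c by rewrite mulr_gt0 ?powR_gt0 ?expR_gt0.
exists (((expR 1 - 1) * c)^-1); first by rewrite invr_gt0 mulr_gt0.
move=> phi phi0 mphi; rewrite lee_pdivlMl; last exact: mulr_gt0.
rewrite EFinM -muleA -nneseriesZl; last first.
  by move=> n _; rewrite lee_fin powR_ge0.
rewrite -integral_eadic; last by move=> n; rewrite mulr_ge0 ?powR_ge0 ?ltW.
rewrite [leLHS]integral_mkcond [leRHS]integral_mkcond.
apply: ge0_le_integral_nonmeas => u; rewrite /patch.
  by case: ifPn => // _; rewrite lee_fin !mulr_ge0 ?expR_ge0 ?powR_ge0// ltW.
case: ifPn => // /[!inE]/=; rewrite in_itv/= andbT => u0.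
have /andP[h1 h2] := eadicP u0; rewrite lee_fin.
have -> (p x : R) : expR x * (c * p) = expR (x - 1) * (expR (- (2 * N)) `^ q * p).
  by rewrite /c expRD; ring.
rewrite ler_pM ?mulr_ge0 ?expR_ge0 ?powR_ge0//; first by rewrite ler_expR; lra.
rewrite -powRM ?expR_ge0 ?phi0 ?expR_gt0//.
apply: ge0_ler_powR; rewrite ?nnegrE ?mulr_ge0 ?expR_ge0 ?phi0 ?expR_gt0 ?(ltW q0)//.
rewrite expRN mulrC ler_pdivrMr ?expR_gt0//.
apply: moderate_le => //; rewrite ?expR_gt0 ?phi0// expRK.
by rewrite ler0_norm; lra.
Qed.

Lemma moderate_peak (e y M : R) : 0 <= e -> 0 <= M ->
  moderate e (fun u => M * expR (- (e * `|ln u - y|))).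
Proof.
move=> e0 M0 u v u0 v0; rewrite -mulrA -expRD ler_wpM2l// ler_expR.
have := ler_distD (ln u) (ln v) y; rewrite (distrC (ln v) (ln u)).
set A := `|_|; set B := `|_|; set E := `|_| => h.
by have := ler_wpM2l e0 h; lra.
Qed.

Lemma Lqy_le (D : set R) (F : R -> \bar R) (M : R) : 0 <= M ->
  (forall u, D u -> 0 <= F u <= M%:E)%E -> (Lq +oo D F <= M%:E)%E.
Proof.
move=> M0 FM; rewrite /Lq (LnormyE leb_setT_gt0).
apply/ess_supP; apply: nearW => u /=; rewrite /patch.
case: ifPn => [/[!inE] /FM /andP[F0 FM']|_]; last by rewrite abse0 lee_fin.
by rewrite gee0_abs.
Qed.

(** A two-sided exponential peak has norm comparable to its height, uniformly in its centre y. All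
    later upper bounds reduce to finding the centre and the height of such a majorant. *)
Lemma Lq_peak_le (q : \bar R) (e : R) : (0 < q)%E -> 0 < e -> exists2 C : R, 0 < C &
  forall (D : set R) (F : R -> \bar R) (y M : R), 0 <= M ->
    (forall u, D u -> 0 < u) -> (forall u, D u -> 0 <= F u)%E ->
    (forall u, D u -> F u <=
       (u `^ (- recip q) * (M * expR (- (e * `|ln u - y|))))%:E)%E ->
    (Lq q D F <= (C * M)%:E)%E.
Proof.
case: q => [q|_|//]; last first.
  move=> e0; exists 1 => // D F y M M0 D0 F0 FM.
  rewrite mul1r; apply: Lqy_le => // u Du; rewrite F0//=.
  rewrite (le_trans (FM _ Du))// lee_fin recipy oppr0 powRr0 mul1r.
  by rewrite ler_piMr// -[leRHS]expR0 ler_expR oppr_le0 mulr_ge0// ltW.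
rewrite lte_fin => q0 e0.
have [C1 C10 H1] := @int_le_series q e q0 (ltW e0).
have [C2 C20 H2] := @separated_series_expR R (q * e) 1 0 (mulr_gt0 q0 e0) ltr01.
exists ((C1 * C2) `^ q^-1); first by rewrite powR_gt0// mulr_gt0.
move=> D F y M M0 D0 F0 FM.
pose phi u := M * expR (- (e * `|ln u - y|)).
have phi0 u : 0 < u -> 0 <= phi u by move=> _; rewrite mulr_ge0 ?expR_ge0.
apply: (@le_trans _ _ (Lq q%:E pos (fun u => (u `^ (- recip q%:E) * phi u)%:E))).
  apply: le_Lq => //; first by move=> u /=; rewrite in_itv/= andbT => u0;
    rewrite lee_fin mulr_ge0 ?powR_ge0 ?phi0.
  by move=> u Du; split; [rewrite /= in_itv/= D0|exact: FM].
rewrite Lq_finE//.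
have -> : (C1 * C2) `^ q^-1 * M = (C1 * (C2 * M `^ q)) `^ q^-1.
  rewrite mulrA (@powRM _ (C1 * C2)) ?powR_ge0 ?mulr_ge0 ?(ltW C10) ?(ltW C20)//.
  by rewrite -(powRrM M) mulfV ?gt_eqF// powRr1.
rewrite -poweR_EFin; apply: ge0_le_poweR; first by rewrite invr_ge0 ltW.
  by apply: integral_ge0 => u _; rewrite lee_fin mulr_ge0 ?expR_ge0 ?powR_ge0.
apply: (le_trans (H1 phi phi0 (moderate_peak _ (ltW e0) M0))).
rewrite EFinM; apply: lee_wpmul2l; first by rewrite lee_fin ltW.
have hp n : (phi (expR (int_of_nat n)%:~R) `^ q)%:E =
    ((M `^ q)%:E * (expR (- (q * e * `|y - (int_of_nat n)%:~R|)))%:E)%E.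
  rewrite -EFinM /phi expRK powRM ?expR_ge0//; congr (_ * _)%:E.
  by rewrite powRE ?expR_gt0// expRK mulrN mulrA distrC.
under eq_eseriesr do rewrite hp.
rewrite nneseriesZl; last by move=> n _; rewrite lee_fin expR_ge0.
rewrite (mulrC C2) EFinM; apply: lee_wpmul2l; first by rewrite lee_fin powR_ge0.
by apply: (H2 (fun k => k%:~R)) => k l; rewrite mul1r subr0.
Qed.

(** The counterpart of the peak bound: the interval from e^y to e^(y+1) has du/u-measure 1. For q =
    oo its positive Lebesgue measure suffices. *)
Lemma Lq_ge_const (q : \bar R) : (0 < q)%E -> exists2 C : R, 0 < C &
  forall (D : set R) (F : R -> \bar R) (y M : R), 0 <= M ->
    (forall u, D u -> 0 <= F u)%E ->
    (forall u, expR y < u < expR (y + 1) ->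
       D u /\ ((u `^ (- recip q) * M)%:E <= F u)%E) ->
    (M%:E <= C%:E * Lq q D F)%E.
Proof.
have leI (y : R) : leb `]expR y, expR (y + 1)[%classic = (expR y * (expR 1 - 1))%:E.
  rewrite leb_itv /= lte_fin ltr_expR ltrDl ltr01.
  by rewrite -EFinB expRD mulrBr mulr1.
have e1 : 0 < expR 1 - 1 :> R by rewrite subr_gt0 expR_gt1.
have mI (y : R) : measurable (`]expR y, expR (y + 1)[%classic : set lebT).
  by apply: measurable_leb; exact: measurable_itv.
case: q => [q|_|//]; last first.
  exists 1 => // D F y M M0 F0 FM; rewrite mul1e leNgt; apply/negP => ltM.
  have := ess_sup_ge leb (fun u => `|(F \_ D) u|%E).
  rewrite -(LnormyE leb_setT_gt0) => /negligibleS.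
  move=> /(_ `]expR y, expR (y + 1)[%classic) -/(_ _)/negligibleP.
  have -> : (leb `]expR y, expR (y + 1)[%classic = 0 <-> False)%E.
    rewrite leI; split => // -[] /eqP; rewrite gt_eqF// mulr_gt0//; exact: expR_gt0.
  apply => //.
  move=> u /=; rewrite in_itv /= => /FM[Du]; rewrite recipy oppr0 powRr0 mul1r => leM.
  rewrite /patch mem_set// gee0_abs ?F0// => leF.
  by have := lt_le_trans ltM (le_trans leM leF); rewrite ltxx.
rewrite lte_fin => q0.
(* Length e^y (e - 1) times the lower bound e^(-(y+1)) of 1/u. *)
exists ((expR (-1) * (expR 1 - 1)) `^ - q^-1).
  by rewrite powR_gt0// mulr_gt0// expR_gt0.
move=> D F y M M0 F0 FM.
set c := expR (-1) * (expR 1 - 1).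
have c0 : 0 < c by rewrite mulr_gt0// expR_gt0.
rewrite powRN lee_pdivlMl ?powR_gt0//.
rewrite /Lq LnormE.
have -> : ((c `^ q^-1)%:E * M%:E)%E = ((c * M `^ q)%:E `^ q^-1)%E.
  rewrite poweR_EFin -EFinM; congr EFin.
  rewrite (@powRM _ c) ?powR_ge0 ?(ltW c0)//.
  by rewrite -(powRrM M) mulfV ?gt_eqF// powRr1.
apply: ge0_le_poweR; first by rewrite invr_ge0 ltW.
  by rewrite lee_fin mulr_ge0 ?powR_ge0 ?(ltW c0).
pose A : set lebT := `]expR y, expR (y + 1)[%classic.
apply: (@le_trans _ _ (\int[leb]_(u in A) (cst (expR (- (y + 1)) * M `^ q)%:E) u)%E).
  rewrite (integral_cst leb (mI y)) [X in (_ * X)%E]leI -EFinM lee_fin.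
  rewrite opprD addrC expRD /c le_eqVlt; apply/orP; left; apply/eqP.
  rewrite -[LHS]mul1r -(expRxMexpNx_1 y); ring.
rewrite [leLHS]integral_mkcond; apply: ge0_le_integral_nonmeas => u; rewrite {1}/patch.
  by case: ifPn => // _; rewrite /cst lee_fin mulr_ge0 ?expR_ge0 ?powR_ge0.
case: ifPn => [/[!inE]|_]; last exact: poweR_ge0.
rewrite /A /= in_itv /= => hu; have [Du leF] := FM _ hu.
rewrite /patch mem_set// gee0_abs ?F0//.
apply: le_trans (ge0_le_poweR (ltW q0) _ leF); last first.
  by rewrite lee_fin mulr_ge0 ?powR_ge0.
have u0 : 0 < u by case/andP: hu => h _; rewrite (lt_trans (expR_gt0 y)).
rewrite poweR_EFin powRM ?powR_ge0// lee_fin ler_wpM2r ?powR_ge0//.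
rewrite recip_fin// -powRrM mulNr mulVf ?gt_eqF// powRE// mulN1r ler_expR lerN2.
by case/andP: hu => _; rewrite -{1}(lnK u0) ltr_expR => /ltW.
Qed.

End LqEstimates.

(** * A Hardy-type inequality with change of variable *)

Section Transfer.
Context {R : realType}.

Local Notation lebT :=
  (caratheodory_type ((wlength (idfun : R -> R))^*)%mu).
Local Notation pos := (`]0, +oo[%classic : set R).

(** Moderation keeps phi above e^(-2N) phi(u) between u and e * u, so the constant lower bound
    applies there. *)
Lemma Lq_ge_pointwise (q : \bar R) (N : R) : (0 < q)%E -> 0 <= N ->
  exists2 C : R, 0 < C & forall phi : R -> R,
    (forall u, 0 < u -> 0 <= phi u) -> moderate N phi ->
    forall u, 0 < u ->
      ((phi u)%:E <= C%:E * Lq q pos (fun v => (v `^ (- recip q) * phi v)%:E))%E.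
Proof.
move=> q0 N0; have [C C0 H] := @Lq_ge_const R q q0.
exists (C * expR (2 * N)) => [|phi phi0 mphi u u0]; first by rewrite mulr_gt0// expR_gt0.
rewrite EFinM muleAC; apply: le_trans (lee_wpmul2r _ (H pos _ (ln u) (phi u * expR (- (2 * N))) _ _ _)).
- by rewrite -EFinM -mulrA -expRD addNr expR0 mulr1.
- by rewrite lee_fin expR_ge0.
- by rewrite mulr_ge0 ?phi0 ?expR_ge0.
- by move=> v /=; rewrite in_itv/= andbT => v0; rewrite lee_fin mulr_ge0 ?powR_ge0 ?phi0.
move=> v /andP[]; rewrite lnK// => uv vu.
have v0 : 0 < v by exact: lt_trans uv.
split; first by rewrite /= in_itv/= v0.
rewrite lee_fin ler_wpM2l ?powR_ge0//.
rewrite expRN ler_pdivrMr ?expR_gt0//.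
apply: moderate_le => //; first exact: phi0.
move: vu; rewrite -{1}(lnK v0) ltr_expR => vu.
have : ln u <= ln v by rewrite ler_ln// ltW.
by move=> uv'; rewrite ler0_norm; lra.
Qed.

(* Hardy's inequality and a change of variables at once: [Phi] is controlled by
   the supremum of [phi] against a weight decaying away from [sigma t], and the
   separation of [sigma] makes the resulting double sum summable in [t]. *)
Lemma Lq_transfer (q : \bar R) (N delta kappa c C : R) (sigma : R -> R) :
  (0 < q)%E -> 0 <= N -> 0 < delta -> 0 < kappa -> 0 < C ->
  (forall s t, 0 < s -> 0 < t ->
     kappa * `|ln s - ln t| - c <= `|ln (sigma s) - ln (sigma t)|) ->
  exists2 C' : R, 0 < C' & forall Phi phi : R -> R,
    (forall u, 0 < u -> 0 <= Phi u) -> (forall u, 0 < u -> 0 <= phi u) ->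
    moderate N Phi -> moderate N phi ->
    (forall t B, 0 < t -> 0 < B ->
       (forall u, 0 < u -> phi u <= B * expR (delta * `|ln u - ln (sigma t)|)) ->
       Phi t <= C * B) ->
    (Lq q pos (fun u => (u `^ (- recip q) * Phi u)%:E) <=
     C'%:E * Lq q pos (fun u => (u `^ (- recip q) * phi u)%:E))%E.
Proof.
move=> q0 N0 d0 k0 C0 sep.
have [Cp Cp0 Hp] := Lq_ge_pointwise q0 N0.
(* The hypothesis is extended to B = 0 by enlarging B slightly, because the B obtained below from
   sums or norms may vanish. *)
have H0 (Phi phi : R -> R) :
    (forall t B, 0 < t -> 0 < B ->
       (forall u, 0 < u -> phi u <= B * expR (delta * `|ln u - ln (sigma t)|)) ->
       Phi t <= C * B) ->
    (forall t B, 0 < t -> 0 <= B ->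
       (forall u, 0 < u -> phi u <= B * expR (delta * `|ln u - ln (sigma t)|)) ->
       Phi t <= C * B).
  move=> H t B t0 B0 hB; apply/ler_addgt0Pr => e e0.
  have -> : C * B + e = C * (B + e / C) by field; rewrite gt_eqF.
  apply: H => // [|u u0]; first by rewrite ltr_wpDl// divr_gt0.
  apply: (le_trans (hB u u0)); rewrite ler_wpM2r ?expR_ge0// lerDl.
  by rewrite divr_ge0// ltW.
case: q q0 Hp => [q|_ Hp|//]; last first.
  exists (C * Cp) => [|Phi phi Phi0 phi0 mPhi mphi H]; first exact: mulr_gt0.
  have HL := Hp phi phi0 mphi.
  pose L := Lq +oo%E pos (fun u => (u `^ (- recip +oo%E) * phi u)%:E).
  rewrite -/L in HL *.
  have L0 : (0 <= L)%E by exact: Lq_ge0.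
  have [Ly|] := eqVneq L +oo%E.
    by rewrite Ly gt0_muley ?leey// lte_fin mulr_gt0.
  move=> LNy; have Lfin : L \is a fin_num by rewrite ge0_fin_numE// ltey.
  rewrite -(fineK Lfin) -EFinM; apply: Lqy_le.
    by rewrite !mulr_ge0 ?(ltW C0) ?(ltW Cp0) ?fine_ge0.
  move=> u /=; rewrite in_itv/= andbT => u0.
  rewrite recipy oppr0 powRr0 mul1r !lee_fin Phi0//= -mulrA.
  apply: (H0 _ _ H) => //; first by rewrite mulr_ge0 ?(ltW Cp0) ?fine_ge0.
  move=> v v0; have := HL v v0; rewrite -(fineK Lfin) -EFinM lee_fin => /le_trans; apply.
  rewrite ler_peMr ?mulr_ge0 ?(ltW Cp0) ?fine_ge0// -[leLHS]expR0 ler_expR.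
  by rewrite mulr_ge0// ltW.
rewrite lte_fin => q0 Hp.
have [C1 C10 H1] := int_le_series q0 N0.
have [C2 C20 H2] := series_le_int q0 N0.
have [C3 C30 H3] := @separated_series_expR R (delta * q) kappa c (mulr_gt0 d0 q0) k0.
pose D := expR (2 * N) : R.
(* D pays for replacing phi(u) by its value at the e-adic point below u, and [expR delta] for moving
   the centre distance from that point to u. *)
pose K := (C * (D * expR delta)) `^ q.
have K0 : 0 < K by rewrite powR_gt0// !mulr_gt0 ?expR_gt0.
exists ((C1 * (K * (C3 * C2))) `^ q^-1); first by rewrite powR_gt0 ?mulr_gt0.
move=> Phi phi Phi0 phi0 mPhi mphi H.
rewrite !Lq_finE//; set I := (X in (_ <= _ * X `^ _)%E).
have I0 : (0 <= I)%E.
  by apply: integral_ge0 => u _; rewrite lee_fin mulr_ge0 ?expR_ge0 ?powR_ge0.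
rewrite -poweR_EFin -poweRM//; last by rewrite lee_fin !mulr_ge0// ltW.
apply: ge0_le_poweR; first by rewrite invr_ge0 ltW.
  by apply: integral_ge0 => u _; rewrite lee_fin mulr_ge0 ?expR_ge0 ?powR_ge0.
have [Iy|INy] := eqVneq I +oo%E.
  by rewrite Iy gt0_muley ?leey// lte_fin !mulr_gt0.
apply: (le_trans (H1 _ Phi0 mPhi)).
rewrite EFinM -muleA lee_wpmul2l ?lee_fin ?(ltW C10)//.
pose z (n : nat) : R := (int_of_nat n)%:~R.
pose p n : R := phi (expR (z n)).
pose y n : R := ln (sigma (expR (z n))).
have p0 n : 0 <= p n by rewrite phi0 ?expR_gt0.
pose w n m : R := expR (- (delta * q * `|z m - y n|)).
pose S n := (\sum_(m <oo) (w n m * p m `^ q)%:E)%E.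
have SI : (\sum_(n <oo) (p n `^ q)%:E <= C2%:E * I)%E by exact: H2.
have S0 n : (0 <= S n)%E.
  by apply: nneseries_ge0 => m _ _; rewrite lee_fin mulr_ge0 ?expR_ge0 ?powR_ge0.
(* The weights w are at most 1, so S n is bounded by the unweighted series, finite in the remaining
   case of finite I. *)
have Sfin n : S n \is a fin_num.
  rewrite ge0_fin_numE// (@le_lt_trans _ _ (C2%:E * I)%E)//; last first.
    by rewrite lte_mul_pinfty ?lee_fin ?(ltW C20)// ltey.
  apply: le_trans SI; apply: lee_nneseries => m *.
    by rewrite lee_fin mulr_ge0 ?expR_ge0 ?powR_ge0.
  rewrite lee_fin ler_piMl ?powR_ge0// -[leRHS]expR0 ler_expR oppr_le0.
  by rewrite !mulr_ge0// ltW.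
(* The hypothesis is used with B = D * e^delta * (S n)^(1/q): each weighted term of the series is at
   most its sum, which bounds the supremum of phi against the decaying weight. *)
have HS n : (Phi (expR (z n))) `^ q <= K * fine (S n).
  rewrite -[fine (S n)](powRr1 (fine_ge0 (S0 n))) -(mulVf (lt0r_neq0 q0)) powRrM.
  rewrite -powRM ?powR_ge0 ?mulr_ge0 ?expR_ge0 ?(ltW C0)//.
  apply: ge0_ler_powR; rewrite ?nnegrE ?(ltW q0) ?Phi0 ?expR_gt0 ?mulr_ge0 ?powR_ge0 ?expR_ge0 ?(ltW C0)//.
  rewrite -mulrA; apply: (H0 _ _ H); rewrite ?expR_gt0 ?mulr_ge0 ?powR_ge0 ?expR_ge0//.
  move=> u u0; have /andP[h1 h2] := eadicP u0; set m := eadic u in h1 h2.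
  have hm : w n m * p m `^ q <= fine (S n).
    rewrite -lee_fin fineK//.
    apply: (@le_term_nneseries R (fun m => (w n m * p m `^ q)%:E) m) => k.
    by rewrite lee_fin mulr_ge0 ?expR_ge0 ?powR_ge0.
  have hm2 : expR (- (delta * `|z m - y n|)) * p m <= fine (S n) `^ q^-1.
    have -> : expR (- (delta * `|z m - y n|)) * p m = (w n m * p m `^ q) `^ q^-1.
      rewrite powRM ?expR_ge0 ?powR_ge0// -powRrM mulfV ?gt_eqF// powRr1//.
      congr (_ * _); rewrite powRE ?expR_gt0// expRK.
      by congr expR; field; rewrite gt_eqF.
    apply: ge0_ler_powR; rewrite ?nnegrE ?invr_ge0 ?(ltW q0) ?mulr_ge0 ?expR_ge0 ?powR_ge0 ?fine_ge0//.
  have h3 : phi u <= p m * D.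
    apply: moderate_le => //; [exact: expR_gt0|exact: p0|rewrite expRK].
    by rewrite ger0_norm -/(z m); lra.
  have h5 : p m <= expR (delta * `|z m - y n|) * fine (S n) `^ q^-1.
    by rewrite -ler_pdivrMl ?expR_gt0// -expRN.
  have h6 : expR (delta * `|z m - y n|) <= expR delta * expR (delta * `|ln u - y n|).
    rewrite -expRD ler_expR; have := ler_distD (ln u) (z m) (y n).
    have -> : `|z m - ln u| = ln u - z m by rewrite ler0_norm /z; lra.
    by move=> h4; have := ler_wpM2l (ltW d0) h4; rewrite /z in h1 h2 *; nra.
  apply: (le_trans h3).
  apply: (@le_trans _ _ (D * (expR delta * expR (delta * `|ln u - y n|) * fine (S n) `^ q^-1))).
    rewrite mulrC ler_wpM2l ?expR_ge0//; apply: (le_trans h5).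
    by rewrite ler_wpM2r ?powR_ge0.
  by rewrite le_eqVlt; apply/orP; left; apply/eqP; ring.
apply: (@le_trans _ _ (\sum_(n <oo) (K%:E * S n))%E).
  apply: lee_nneseries => n *; first by rewrite lee_fin powR_ge0.
  by rewrite -(fineK (Sfin n)) -EFinM lee_fin HS.
rewrite nneseriesZl// [in leRHS]EFinM -muleA lee_wpmul2l ?lee_fin ?(ltW K0)//.
(* After the interchange, the inner sum of w n m over n is bounded uniformly in m, because [sep]
   separates the centres y n. *)
rewrite /S nneseries_interchange; last first.
  by move=> i j; rewrite lee_fin mulr_ge0 ?expR_ge0 ?powR_ge0.
rewrite EFinM -muleA.
apply: le_trans (lee_wpmul2l _ SI); last by rewrite lee_fin ltW.
rewrite -nneseriesZl; last by move=> n _; rewrite lee_fin powR_ge0.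
apply: lee_nneseries => [m *|m _].
  by apply: nneseries_ge0 => n _ _; rewrite lee_fin mulr_ge0 ?expR_ge0 ?powR_ge0.
under eq_eseriesr do rewrite mulrC EFinM.
rewrite nneseriesZl; last by move=> n _; rewrite lee_fin expR_ge0.
rewrite muleC lee_wpmul2r ?lee_fin ?powR_ge0//.
apply: (H3 (fun k => ln (sigma (expR k%:~R)))) => k l.
by have := sep _ _ (expR_gt0 k%:~R) (expR_gt0 l%:~R); rewrite !expRK.
Qed.

End Transfer.

(** * Slowly varying functions *)

Section Slow.
Context {R : realType}.

Local Notation lebT :=
  (caratheodory_type ((wlength (idfun : R -> R))^*)%mu).
Local Notation pos := (`]0, +oo[%classic : set R).

(** Up to a constant, f(s)/f(t) <= max(s/t, t/s)^e for every e > 0, in logarithmic form; exchanging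
    s and t gives the lower bound. In this form stability under products, powers and composition is
    linear arithmetic. *)
Definition slow (f : R -> R) :=
  (forall t, 0 < t -> 0 < f t) /\
  forall e, 0 < e -> exists C : R, forall s t, 0 < s -> 0 < t ->
    ln (f s) <= ln (f t) + e * `|ln s - ln t| + C.

(** For s <= t the almost increasing t^e b(t) is used, for t <= s the almost decreasing t^(-e) b(t);
    each equivalence constant is paid twice. *)
Lemma SV_slow (b : R -> R) : SV b -> slow b.
Proof.
move=> [b0 _ H]; split => // e e0.
have [[g [g0 gi [C1 C10 H1]]] [h [h0 hd [C2 C20 H2]]]] := H e e0.
have lnb p t : 0 < t -> ln (t `^ p * b t) = p * ln t + ln (b t).
  by move=> t0; rewrite lnM ?posrE ?powR_gt0 ?b0// ln_powR.
have le_ln (C x y : R) : 0 < C -> 0 < x -> 0 < y -> x <= C * y ->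
    ln x <= ln C + ln y.
  move=> C0 x0 y0 xy; rewrite -lnM ?posrE// ler_ln ?posrE//; exact: mulr_gt0.
exists (2 * `|ln C1| + 2 * `|ln C2|) => s t s0 t0.
have A1 := ler_norm (ln C1); have A2 := ler_norm (ln C2).
have N1 := normr_ge0 (ln C1); have N2 := normr_ge0 (ln C2).
have [st|/ltW ts] := leP s t.
  have h1 := le_ln _ _ _ C10 (mulr_gt0 (powR_gt0 e s0) (b0 s s0)) (g0 s s0) (H1 s s0).1.
  have h2 := le_ln _ _ _ C10 (g0 t t0) (mulr_gt0 (powR_gt0 e t0) (b0 t t0)) (H1 t t0).2.
  have h3 : ln (g s) <= ln (g t) by rewrite ler_ln ?posrE ?g0// gi.
  have h4 : ln s <= ln t by rewrite ler_ln.
  rewrite lnb // in h1; rewrite lnb // in h2.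
  have -> : `|ln s - ln t| = ln t - ln s by rewrite ler0_norm; lra.
  lra.
have h1 := le_ln _ _ _ C20 (mulr_gt0 (powR_gt0 (- e) s0) (b0 s s0)) (h0 s s0) (H2 s s0).1.
have h2 := le_ln _ _ _ C20 (h0 t t0) (mulr_gt0 (powR_gt0 (- e) t0) (b0 t t0)) (H2 t t0).2.
have h3 : ln (h s) <= ln (h t) by rewrite ler_ln ?posrE ?h0// hd.
have h4 : ln t <= ln s by rewrite ler_ln.
rewrite lnb // in h1; rewrite lnb // in h2.
have -> : `|ln s - ln t| = ln s - ln t by rewrite ger0_norm; lra.
lra.
Qed.

Lemma slowM f g : slow f -> slow g -> slow (fun t => f t * g t).
Proof.
move=> [f0 Hf] [g0 Hg]; split => [t t0|e e0]; first by rewrite mulr_gt0 ?f0 ?g0.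
have [C1 H1] := Hf _ (divr_gt0 e0 (ltr0Sn R 1)).
have [C2 H2] := Hg _ (divr_gt0 e0 (ltr0Sn R 1)).
exists (C1 + C2) => s t s0 t0; rewrite !lnM ?posrE ?f0 ?g0//.
by have := H1 s t s0 t0; have := H2 s t s0 t0; lra.
Qed.

Lemma slow_powR f p : slow f -> slow (fun t => f t `^ p).
Proof.
move=> [f0 Hf]; split => [t t0|e e0]; first by rewrite powR_gt0 ?f0.
(* Adding 1 to |p| keeps the division legitimate when p = 0. *)
have p1 : 0 < `|p| + 1 by rewrite ltr_wpDl.
have [C H] := Hf _ (divr_gt0 e0 p1).
exists (`|p| * C) => s t s0 t0; rewrite !ln_powR.
have : `|ln (f s) - ln (f t)| <= e / (`|p| + 1) * `|ln s - ln t| + C.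
  rewrite ler_norml; have := H s t s0 t0; have := H t s t0 s0.
  by rewrite (distrC (ln t)); lra.
move=> /(ler_wpM2l (normr_ge0 p)); rewrite -normrM (mulrDr `|p|) => h.
have h1 := ler_norm (p * (ln (f s) - ln (f t))).
have h2 : `|p| * (e / (`|p| + 1) * `|ln s - ln t|) <= e * `|ln s - ln t|.
  rewrite mulrA ler_wpM2r// mulrCA ler_piMr ?(ltW e0)//.
  by rewrite ler_pdivrMr//; lra.
lra.
Qed.

Lemma slowV f : slow f -> slow (fun t => (f t)^-1).
Proof.
move=> [f0 Hf]; split => [t t0|e e0]; first by rewrite invr_gt0 f0.
have [C H] := Hf _ e0; exists C => s t s0 t0.
rewrite !lnV ?posrE ?f0//; have := H t s t0 s0; rewrite (distrC (ln t)); lra.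
Qed.

Lemma slow_comp f (rho : R -> R) (n c : R) : 0 < n -> slow f ->
  (forall t, 0 < t -> 0 < rho t) ->
  (forall s t, 0 < s -> 0 < t ->
     `|ln (rho s) - ln (rho t)| <= n * `|ln s - ln t| + c) ->
  slow (fun t => f (rho t)).
Proof.
move=> n0 [f0 Hf] rho0 hrho; split => [t t0|e e0]; first by rewrite f0 ?rho0.
have [C H] := Hf _ (divr_gt0 e0 n0).
exists (C + e / n * c) => s t s0 t0.
apply: (le_trans (H _ _ (rho0 s s0) (rho0 t t0))).
have := ler_wpM2l (ltW (divr_gt0 e0 n0)) (hrho s t s0 t0).
have -> : e / n * (n * `|ln s - ln t| + c) = e * `|ln s - ln t| + e / n * c.
  by field; rewrite gt_eqF.
lra.
Qed.

Lemma slow_le f (e : R) : slow f -> 0 < e -> exists2 C : R, 0 < C &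
  forall s t, 0 < s -> 0 < t -> f s <= C * f t * expR (e * `|ln s - ln t|).
Proof.
move=> [f0 Hf] e0; have [C H] := Hf e e0.
exists (expR C) => [|s t s0 t0]; first exact: expR_gt0.
rewrite -{1}(lnK (f0 s s0)) -{1}(lnK (f0 t t0)) -!expRD ler_expR.
by have := H s t s0 t0; lra.
Qed.

Lemma measurable_weight (A : set R) (p : R) (h : R -> R) :
  measurable (A : set (measurableTypeR R)) -> A `<=` pos ->
  measurable_fun (pos : set lebT) (h : lebT -> measurableTypeR R) ->
  measurable_fun (A : set lebT) (fun u : lebT => (u `^ p * h u)%:E).
Proof.
move=> mA Apos mh.
have mA' := measurable_leb mA.
have mpos : measurable (pos : set lebT).
  by apply: measurable_leb; exact: measurable_itv.
apply/measurable_EFinP; apply: measurable_funM; last first.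
  exact: (measurable_funS mpos Apos).
have mp : measurable_fun [set: lebT] ((fun u => u `^ p) : lebT -> measurableTypeR R).
  by move=> _ Y mY; apply: measurable_leb; exact: (@measurable_powR R p).
exact: (measurable_funS measurableT (@subsetT _ _) mp).
Qed.

(** * Slow variation of head and tail norms *)

Section HeadTail.
Variables (q : \bar R) (h : R -> R).
Hypotheses (q0 : (0 < q)%E) (hs : slow h)
  (mh : measurable_fun (pos : set lebT) (h : lebT -> measurableTypeR R)).

Local Notation w := (fun s => (s `^ (- recip q) * h s)%:E).

Let w0 s : 0 < s -> (0 <= w s)%E.
Proof. by move=> s0; rewrite lee_fin mulr_ge0 ?powR_ge0 ?(ltW (hs.1 _ s0)). Qed.

(* [D] is the family of tails or of heads of the half-line; [lt s t] says that
   [D t] is the smaller one. *)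
Let slow_norm (D : R -> set R) (lt : R -> R -> Prop) :
  (forall t, 0 < t -> D t `<=` pos) ->
  (forall s t, 0 < s -> 0 < t -> lt s t \/ lt t s) ->
  (forall s t, 0 < s -> 0 < t -> lt s t -> D t `<=` D s) ->
  (exists2 C : R, 0 < C & forall t, 0 < t -> ((h t)%:E <= C%:E * Lq q (D t) w)%E) ->
  (forall e, 0 < e -> exists2 C : R, 0 < C & forall s t, 0 < s -> 0 < t -> lt s t ->
     (Lq q (D s) w <= C%:E * (Lq q (D t) w +
        (h t * expR (e * `|ln s - ln t|))%:E))%E) ->
  (Lq q (D 1%R) w < +oo)%E ->
  [/\ forall t, 0 < t -> Lq q (D t) w = (fine (Lq q (D t) w))%:E,
      slow (fun t => fine (Lq q (D t) w))
    & exists2 C : R, 0 < C & forall t, 0 < t -> h t <= C * fine (Lq q (D t) w)].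
Proof.
move=> Dpos tot mono [C C0 low] split fin1.
have le_D s t : 0 < s -> 0 < t -> lt s t -> (Lq q (D t) w <= Lq q (D s) w)%E.
  move=> s0 t0 st; have Dst := mono _ _ s0 t0 st.
  apply: le_Lq => // [u|u|u Du].
  - by move=> /(Dpos _ t0) /=; rewrite in_itv/= andbT; exact: w0.
  - by move=> /(Dpos _ s0) /=; rewrite in_itv/= andbT; exact: w0.
  - by split => //; exact: Dst.
(* Finiteness at 1 propagates by monotonicity to smaller sets and by [split] to larger ones. *)
have fin t : 0 < t -> Lq q (D t) w \is a fin_num.
  move=> t0; rewrite ge0_fin_numE ?Lq_ge0//.
  have [lt1|lt1] := tot t 1 t0 ltr01; last exact: le_lt_trans (le_D _ _ _ _ lt1) fin1.
  have [C1 C10 H1] := split 1 ltr01.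
  apply: (le_lt_trans (H1 t 1 t0 ltr01 lt1)).
  apply: lte_mul_pinfty; rewrite ?lee_fin ?(ltW C10)//.
  by apply: lte_add_pinfty => //; rewrite ltry.
have finE t : 0 < t -> Lq q (D t) w = (fine (Lq q (D t) w))%:E.
  by move=> t0; rewrite fineK// fin.
have lowR t : 0 < t -> h t <= C * fine (Lq q (D t) w).
  by move=> t0; rewrite -lee_fin EFinM -finE// low.
have H0 t : 0 < t -> 0 < fine (Lq q (D t) w).
  by move=> t0; rewrite -(pmulr_rgt0 _ C0); apply: lt_le_trans (lowR t t0); exact: hs.1.
split => //; last by exists C.
split => // e e0; have [C1 C10 H1] := split e e0.
have K0 : 0 < C1 * (1 + C) by rewrite mulr_gt0// addr_gt0.
exists `|ln (C1 * (1 + C))| => s t s0 t0.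
have e1 : 0 <= e * `|ln s - ln t| by rewrite mulr_ge0// ltW.
(* If D s is the smaller set, monotonicity gives the bound without loss; otherwise [split] applies
   and [low] absorbs h(t) into the norm over D t. *)
have [st|ts] := tot s t s0 t0; last first.
  have : ln (fine (Lq q (D s) w)) <= ln (fine (Lq q (D t) w)).
    by rewrite ler_ln ?posrE ?H0// -lee_fin -!finE// le_D.
  have := normr_ge0 (ln (C1 * (1 + C))); lra.
have : fine (Lq q (D s) w) <=
    C1 * (1 + C) * fine (Lq q (D t) w) * expR (e * `|ln s - ln t|).
  have := H1 s t s0 t0 st; rewrite (finE s)// (finE t)// -EFinD -EFinM lee_fin.
  move=> /le_trans; apply; rewrite -!mulrA ler_wpM2l ?(ltW C10)//.
  rewrite mulrDl mul1r lerD//.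
    by rewrite ler_peMr ?(ltW (H0 t t0))// -[leLHS]expR0 ler_expR.
  by rewrite mulrA ler_wpM2r ?expR_ge0// lowR.
rewrite -(ler_ln (x := fine (Lq q (D s) w))) ?posrE ?mulr_gt0 ?H0 ?expR_gt0 ?addr_gt0//.
rewrite lnM ?posrE ?mulr_gt0 ?H0 ?expR_gt0 ?addr_gt0//.
rewrite lnM ?posrE ?mulr_gt0 ?H0 ?addr_gt0// expRK.
have := ler_norm (ln (C1 * (1 + C))); lra.
Qed.

(** D t contains an interval of logarithmic length 1 with t as an endpoint, on which h is comparable
    to h(t). It starts at t for tails (k = 0) and ends at t for heads (k = -1). *)
Let low_const (D : R -> set R) (k : R) :
  (forall t, 0 < t -> D t `<=` pos) -> -1 <= k <= 0 ->
  (forall t u, 0 < t -> expR (ln t + k) < u < expR (ln t + k + 1) -> D t u) ->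
  exists2 C : R, 0 < C & forall t, 0 < t -> ((h t)%:E <= C%:E * Lq q (D t) w)%E.
Proof.
move=> Dpos k01 HD.
have [C1 C10 H1] := slow_le hs ltr01.
have [C2 C20 H2] := Lq_ge_const q0.
exists (C1 * expR 1 * C2) => [|t t0]; first by rewrite !mulr_gt0 ?expR_gt0.
rewrite [X in (X * _)%E]EFinM -muleA -lee_pdivrMl ?mulr_gt0 ?expR_gt0// -EFinM.
apply: (H2 (D t) w (ln t + k)).
- by rewrite mulr_ge0 ?invr_ge0 ?mulr_ge0 ?expR_ge0 ?(ltW C10)// (ltW (hs.1 _ t0)).
- by move=> u /(Dpos _ t0) /=; rewrite in_itv/= andbT; exact: w0.
move=> u hu; split; first exact: HD.
have u0 : 0 < u by case/andP: hu => + _; apply: lt_trans; exact: expR_gt0.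
rewrite lee_fin ler_wpM2l ?powR_ge0// ler_pdivrMl ?mulr_gt0 ?expR_gt0//.
apply: (le_trans (H1 t u t0 u0)); rewrite -mulrA [leRHS]mulrAC -mulrA ler_wpM2l ?(ltW C10)//.
rewrite ler_wpM2l ?(ltW (hs.1 _ u0))// ler_expR mul1r.
move: hu; rewrite -{1 2}(lnK u0) !ltr_expR => /andP[h1 h2].
by rewrite ler_norml; lra.
Qed.

(** The part D1 of D s outside D t lies between s and t. There h(u) <= C h(t) exp(e |ln u - ln t|),
    which by [mid] is a peak centred at s of height h(t) exp(e |ln s - ln t|). *)
Let split_peak (D : R -> set R) (lt : R -> R -> Prop) (D1 : R -> R -> set R) :
  (forall t, 0 < t -> D t `<=` pos) -> (forall s t, 0 < s -> 0 < t -> D1 s t `<=` pos) ->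
  (forall t, measurable (D t : set (measurableTypeR R))) ->
  (forall s t, measurable (D1 s t : set (measurableTypeR R))) ->
  (forall s t u, 0 < s -> 0 < t -> lt s t -> D s u -> D1 s t u \/ D t u) ->
  (forall s t u, 0 < s -> 0 < t -> lt s t -> D1 s t u ->
     `|ln u - ln t| = `|ln s - ln t| - `|ln u - ln s|) ->
  forall e, 0 < e -> exists2 C : R, 0 < C & forall s t, 0 < s -> 0 < t -> lt s t ->
     (Lq q (D s) w <= C%:E * (Lq q (D t) w +
        (h t * expR (e * `|ln s - ln t|))%:E))%E.
Proof.
move=> Dpos D1pos mD mD1 cov mid e e0.
have [C0 C00 H0] := @Lnorm_patch_split _ lebT R leb leb_setT_gt0 q q0.
have [C1 C10 H1] := slow_le hs e0.
have [C2 C20 H2] := Lq_peak_le q0 e0.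
have C21 : 0 < C2 * C1 by exact: mulr_gt0.
exists (C0 * (C2 * C1 + 1)) => [|s t s0 t0 st]; first by rewrite mulr_gt0 ?addr_gt0.
have pw (A : set R) u : A `<=` pos -> A u -> (0 <= w u)%E.
  by move=> /[apply] /=; rewrite in_itv/= andbT; exact: w0.
apply: (@le_trans _ _ (C0%:E * (Lq q (D1 s t) w + Lq q (D t) w))%E).
  apply: H0.
  - exact: measurable_leb.
  - exact: measurable_leb.
  - by apply: measurable_weight => //; exact: D1pos.
  - by apply: measurable_weight => //; exact: Dpos.
  - by move=> u; apply: pw; exact: Dpos.
  - by move=> u /(cov s t u s0 t0 st) [|]; [left|right].
set M := h t * expR (e * `|ln s - ln t|).
have M0 : 0 <= M by rewrite mulr_ge0 ?expR_ge0// (ltW (hs.1 _ t0)).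
have peak : (Lq q (D1 s t) w <= (C2 * (C1 * M))%:E)%E.
  apply: (H2 _ _ (ln s)) => [|u /D1pos|u|u D1u].
  - by rewrite mulr_ge0// ltW.
  - by rewrite /= in_itv/= andbT; apply.
  - by apply: pw; exact: D1pos.
  have u0 : 0 < u by have := D1pos s t s0 t0 u D1u; rewrite /= in_itv/= andbT.
  rewrite lee_fin ler_wpM2l ?powR_ge0//.
  apply: (le_trans (H1 u t u0 t0)); rewrite (mid s t u)//.
  by rewrite mulrBr expRD /M !mulrA.
have T0 : (0 <= Lq q (D t) w)%E by exact: Lq_ge0.
rewrite EFinM -muleA lee_wpmul2l ?lee_fin ?(ltW C00)//.
apply: (@le_trans _ _ ((C2 * C1)%:E * M%:E + Lq q (D t) w)%E).
  by rewrite leeD2r// -EFinM -mulrA.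
rewrite addeC ge0_muleDr ?lee_fin// leeD//.
  by rewrite lee_pemull// lee_fin lerDr ltW.
by rewrite lee_wpmul2r ?lee_fin// lerDl.
Qed.

Lemma tail_slow : (Lq q `]1%R, +oo[ w < +oo)%E ->
  [/\ forall t, 0 < t -> Lq q `]t, +oo[ w = (fine (Lq q `]t, +oo[ w))%:E,
      slow (fun t => fine (Lq q `]t, +oo[ w))
    & exists2 C : R, 0 < C & forall t, 0 < t -> h t <= C * fine (Lq q `]t, +oo[ w)].
Proof.
have sub t : 0 < t -> `]t, +oo[%classic `<=` pos.
  by move=> t0 u /=; rewrite !in_itv/= !andbT; exact: lt_trans.
apply: (@slow_norm (fun t => `]t, +oo[%classic) (fun s t => s <= t)) => //.
- by move=> s t _ _; have [|/ltW] := leP s t; [left|right].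
- move=> s t s0 t0 st u /=; rewrite !in_itv/= !andbT; exact: le_lt_trans.
- apply: (@low_const _ 0) => //; first by rewrite lexx lerN10.
  move=> t u t0; rewrite addr0 => /andP[+ _] /=.
  by rewrite in_itv/= andbT lnK.
apply: (@split_peak _ _ (fun s t => `]s, t]%classic)) => //.
- by move=> s t s0 t0 u /=; rewrite !in_itv/= andbT => /andP[+ _]; exact: lt_trans.
- move=> s t u s0 t0 st /=; rewrite !in_itv/= !andbT => su.
  by rewrite su/=; have [|] := leP u t; [left|right].
move=> s t u s0 t0 st /=; rewrite in_itv/= => /andP[su ut].
have u0 : 0 < u by exact: lt_trans su.
have h1 : ln s <= ln u by rewrite ler_ln// ltW.
have h2 : ln u <= ln t by rewrite ler_ln.
by rewrite (ger0_norm (x := ln u - ln s)) ?ler0_norm; lra.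
Qed.

Lemma head_slow : (Lq q `]0%R, 1%R[ w < +oo)%E ->
  [/\ forall t, 0 < t -> Lq q `]0, t[ w = (fine (Lq q `]0, t[ w))%:E,
      slow (fun t => fine (Lq q `]0, t[ w))
    & exists2 C : R, 0 < C & forall t, 0 < t -> h t <= C * fine (Lq q `]0, t[ w)].
Proof.
have sub t : `]0, t[%classic `<=` pos.
  by move=> u /=; rewrite !in_itv/= andbT => /andP[].
apply: (@slow_norm (fun t => `]0, t[%classic) (fun s t => t <= s)) => //.
- by move=> s t _ _; have [|/ltW] := leP s t; [right|left].
- move=> s t s0 t0 ts u /=; rewrite !in_itv/= => /andP[-> ut] /=.
  exact: lt_le_trans ts.
- apply: (@low_const _ (-1)) => //; first by rewrite lexx lerN10.
  move=> t u t0; rewrite subrK lnK// => /andP[h1 h2] /=.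
  by rewrite in_itv/= h2 andbT (lt_trans _ h1)// expR_gt0.
apply: (@split_peak _ _ (fun s t => `[t, s[%classic)) => //.
- by move=> s t s0 t0 u /=; rewrite !in_itv/= andbT => /andP[+ _]; exact: lt_le_trans.
- move=> s t u s0 t0 st /=; rewrite !in_itv/= => /andP[-> us].
  by rewrite us andbT; have [|] := leP t u; [left|right].
move=> s t u s0 t0 ts /=; rewrite in_itv/= => /andP[tu us].
have u0 : 0 < u by exact: lt_le_trans tu.
have h1 : ln t <= ln u by rewrite ler_ln.
have h2 : ln u <= ln s by rewrite ler_ln// ltW.
by rewrite (ler0_norm (x := ln u - ln s)) ?ger0_norm; lra.
Qed.

End HeadTail.
End Slow.

(** * The K-functional *)

Section KFunctional.
Context {R : realType} {V : lmodType R}.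
Implicit Types (X Y : @qspace R V) (f g : V).

Definition finite_norm X := forall f, carrier X f -> (0 <= qnorm X f < +oo)%E.

Definition rnorm X f : R := fine (qnorm X f).

(** Since [fine] sends +oo to 0, this carries the K-functional only on the sum space, where it is
    finite. *)
Definition rK X0 X1 t f : R := fine (Kfun X0 X1 t f).

Lemma rnormE X f : finite_norm X -> carrier X f -> qnorm X f = (rnorm X f)%:E.
Proof.
by move=> Xfin /Xfin/andP[h1 h2]; rewrite /rnorm fineK// ge0_fin_numE.
Qed.

Lemma rnorm_ge0 X f : finite_norm X -> carrier X f -> 0 <= rnorm X f.
Proof. by move=> Xfin /Xfin/andP[h _]; exact: fine_ge0. Qed.

Section FiniteNorm.
Variables X0 X1 : @qspace R V.
Hypotheses (X0fin : finite_norm X0) (X1fin : finite_norm X1).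

Lemma Kfun_ge0 t f : 0 <= t -> (0 <= Kfun X0 X1 t f)%E.
Proof.
move=> t0; apply: le_ereal_inf_tmp => _ [f0 [f1 [c0 c1 _ ->]]].
have /andP[h0 _] := X0fin c0; have /andP[h1 _] := X1fin c1.
by rewrite adde_ge0// mule_ge0.
Qed.

Lemma KfunE t f : 0 <= t -> sum_space X0 X1 f ->
  Kfun X0 X1 t f = (rK X0 X1 t f)%:E.
Proof.
move=> t0 [f0 c0 [f1 c1 <-]]; rewrite /rK fineK// ge0_fin_numE ?Kfun_ge0//.
apply: (@le_lt_trans _ _ (qnorm X0 f0 + t%:E * qnorm X1 f1)%E).
  by apply: ereal_inf_lbound; exists f0, f1.
by rewrite (rnormE X0fin c0) (rnormE X1fin c1) -EFinM -EFinD ltry.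
Qed.

Lemma rK_ge0 t f : 0 <= t -> 0 <= rK X0 X1 t f.
Proof. by move=> t0; rewrite fine_ge0// Kfun_ge0. Qed.

Lemma sum_spaceD f0 f1 : carrier X0 f0 -> carrier X1 f1 -> sum_space X0 X1 (f0 + f1).
Proof. by move=> c0 c1; exists f0 => //; exists f1. Qed.

Lemma rK_le t f0 f1 : 0 <= t -> carrier X0 f0 -> carrier X1 f1 ->
  rK X0 X1 t (f0 + f1) <= rnorm X0 f0 + t * rnorm X1 f1.
Proof.
move=> t0 c0 c1; rewrite -lee_fin -KfunE//; last exact: sum_spaceD.
rewrite EFinD EFinM -(rnormE X0fin c0) -(rnormE X1fin c1).
by apply: ereal_inf_lbound; exists f0, f1.
Qed.

Lemma rK_approx t e f : 0 <= t -> 0 < e -> sum_space X0 X1 f ->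
  exists f0 f1, [/\ carrier X0 f0, carrier X1 f1, f = f0 + f1
    & rnorm X0 f0 + t * rnorm X1 f1 <= rK X0 X1 t f + e].
Proof.
move=> t0 e0 sf.
have fin : Kfun X0 X1 t f \is a fin_num by rewrite KfunE.
have [_ [f0 [f1 [c0 c1 -> ->]]]] := lb_ereal_inf_adherent e0 fin.
move=> h; exists f0, f1; split => //; move: h.
rewrite -/(Kfun _ _ _ _) KfunE//; last exact: sum_spaceD.
rewrite (rnormE X0fin c0) (rnormE X1fin c1).
by rewrite -EFinM -!EFinD lte_fin => /ltW.
Qed.

(** A near-optimal splitting at t is tested at s. This holds both the monotonicity of K(t, f) and
    that of K(t, f)/t. *)
Lemma rK_le_max s t f : 0 <= s -> 0 < t -> sum_space X0 X1 f ->
  rK X0 X1 s f <= Num.max 1 (s / t) * rK X0 X1 t f.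
Proof.
move=> s0 t0 sf; set c := Num.max _ _.
have c1 : 1 <= c by rewrite le_max lexx.
have cst : s <= c * t by rewrite -ler_pdivrMr// le_max lexx orbT.
apply/ler_addgt0Pr => e e0.
have c0 : 0 < c by exact: lt_le_trans c1.
have [f0 [f1 [h0 h1 fE le]]] := rK_approx (ltW t0) (divr_gt0 e0 c0) sf.
rewrite fE; apply: (le_trans (rK_le s0 h0 h1)); rewrite -fE.
have -> : c * rK X0 X1 t f + e = c * (rK X0 X1 t f + e / c).
  by field; rewrite gt_eqF.
apply: le_trans (ler_wpM2l (ltW c0) le).
have n0 := rnorm_ge0 X0fin h0; have n1 := rnorm_ge0 X1fin h1.
by rewrite mulrDr lerD// ?mulrA ?ler_wpM2r// ler_peMl.
Qed.

Lemma rK_scale s t f : 0 < t -> t <= s -> sum_space X0 X1 f ->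
  rK X0 X1 s f <= s / t * rK X0 X1 t f.
Proof.
move=> t0 ts sf; have := rK_le_max (le_trans (ltW t0) ts) t0 sf.
by rewrite max_r// ler_pdivlMr// mul1r.
Qed.

Lemma rK_moderate f : sum_space X0 X1 f -> moderate 1 (rK X0 X1 ^~ f).
Proof.
move=> sf u v u0 v0; rewrite mul1r mulrC.
apply: (le_trans (rK_le_max (ltW u0) v0 sf)).
apply: ler_wpM2r; first exact: rK_ge0 (ltW v0).
rewrite ge_max; have h := normr_ge0 (ln u - ln v).
rewrite -{1}expR0 ler_expR addr_ge0//=.
rewrite -{1}(lnK u0) -{1}(lnK v0) -expRB ler_expR.
by have := ler_norm (ln u - ln v); lra.
Qed.

End FiniteNorm.

Lemma quasi_banach_finite X : quasi_banach X -> finite_norm X.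
Proof. by case=> _ h _ _ _ f /h[]. Qed.

Section QuasiBanach.
Variables A0 A1 : @qspace R V.
Hypotheses (hA0 : quasi_banach A0) (hA1 : quasi_banach A1).

Let A0fin := quasi_banach_finite hA0.
Let A1fin := quasi_banach_finite hA1.

Let carrierD X f g : quasi_banach X -> carrier X f -> carrier X g ->
  carrier X (f + g).
Proof. by move=> [[_ h] _ _ _ _] cf cg; have := h 1 _ _ cf cg; rewrite scale1r. Qed.

Let carrier0 X : quasi_banach X -> carrier X 0.
Proof. by case=> [[]]. Qed.

Lemma carrierN X f : quasi_banach X -> carrier X f -> carrier X (- f).
Proof.
move=> hX cf; case: (hX) => [[c0 h] _ _ _ _].
by have := h (-1) _ _ cf c0; rewrite addr0 scaleN1r.
Qed.

Let rnorm0 X : quasi_banach X -> rnorm X 0 = 0.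
Proof.
move=> hX; case: (hX) => _ _ h _ _; have := h 0 _ (carrier0 hX).
by rewrite scale0r normr0 mul0e /rnorm => ->.
Qed.

Lemma rnormN X f : quasi_banach X -> carrier X f -> rnorm X (- f) = rnorm X f.
Proof.
move=> hX cf; case: (hX) => _ _ h _ _; have := h (-1) _ cf.
by rewrite scaleN1r normrN1 mul1e /rnorm => ->.
Qed.

Let rnormD X : quasi_banach X -> exists2 C : R, 0 < C & forall f g,
  carrier X f -> carrier X g -> rnorm X (f + g) <= C * (rnorm X f + rnorm X g).
Proof.
move=> hX; have Xfin := quasi_banach_finite hX; case: (hX) => _ _ _ [C hC] _.
exists (`|C| + 1) => [|f g cf cg]; first by rewrite ltr_wpDl.
have := hC f g cf cg; rewrite !rnormE//; last exact: carrierD.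
rewrite -EFinD -EFinM lee_fin => /le_trans; apply.
rewrite ler_wpM2r ?addr_ge0 ?rnorm_ge0//.
by have := ler_norm C; lra.
Qed.

Lemma sum_space_add f g : sum_space A0 A1 f -> sum_space A0 A1 g ->
  sum_space A0 A1 (f + g).
Proof.
move=> [f0 cf0 [f1 cf1 <-]] [g0 cg0 [g1 cg1 <-]].
by rewrite addrACA; apply: sum_spaceD; exact: carrierD.
Qed.

Lemma carrier_sum0 f : carrier A0 f -> sum_space A0 A1 f.
Proof. by move=> cf; rewrite -(addr0 f); apply: sum_spaceD => //; exact: carrier0. Qed.

Lemma carrier_sum1 f : carrier A1 f -> sum_space A0 A1 f.
Proof. by move=> cf; rewrite -(add0r f); apply: sum_spaceD => //; exact: carrier0. Qed.

Lemma rK_le0 t f : 0 <= t -> carrier A0 f -> rK A0 A1 t f <= rnorm A0 f.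
Proof.
move=> t0 cf; have := rK_le A0fin A1fin t0 cf (carrier0 hA1).
by rewrite addr0 rnorm0// mulr0 addr0.
Qed.

Lemma rK_le1 t f : 0 <= t -> carrier A1 f -> rK A0 A1 t f <= t * rnorm A1 f.
Proof.
move=> t0 cf; have := rK_le A0fin A1fin t0 (carrier0 hA0) cf.
by rewrite !add0r rnorm0// add0r.
Qed.

Lemma rK_quasi_triangle : exists2 C : R, 0 < C & forall t f g, 0 <= t ->
  sum_space A0 A1 f -> sum_space A0 A1 g ->
  rK A0 A1 t (f + g) <= C * (rK A0 A1 t f + rK A0 A1 t g).
Proof.
have [C0 C00 H0] := rnormD hA0; have [C1 C10 H1] := rnormD hA1.
have C01 : 0 < C0 + C1 by rewrite addr_gt0.
exists (C0 + C1) => // t f g t0 sf sg.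
apply/ler_addgt0Pr => e e0.
have e'0 : 0 < e / (2 * (C0 + C1)) by rewrite divr_gt0// mulr_gt0.
have [f0 [f1 [cf0 cf1 fE lef]]] := rK_approx A0fin A1fin t0 e'0 sf.
have [g0 [g1 [cg0 cg1 gE leg]]] := rK_approx A0fin A1fin t0 e'0 sg.
rewrite {1}fE {1}gE addrACA.
apply: (le_trans (rK_le A0fin A1fin t0 (carrierD hA0 cf0 cg0) (carrierD hA1 cf1 cg1))).
apply: (@le_trans _ _ ((C0 + C1) * (rnorm A0 f0 + t * rnorm A1 f1 +
    (rnorm A0 g0 + t * rnorm A1 g1)))).
  have h0 := H0 _ _ cf0 cg0; have h1 := ler_wpM2l t0 (H1 _ _ cf1 cg1).
  have n1 := rnorm_ge0 A0fin cf0; have n2 := rnorm_ge0 A0fin cg0.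
  have n3 := mulr_ge0 t0 (rnorm_ge0 A1fin cf1).
  have n4 := mulr_ge0 t0 (rnorm_ge0 A1fin cg1).
  have m1 := mulr_ge0 (ltW C10) (addr_ge0 n1 n2).
  have m2 := mulr_ge0 (ltW C00) (addr_ge0 n3 n4).
  lra.
apply: le_trans (ler_wpM2l (ltW C01) (lerD lef leg)) _.
rewrite le_eqVlt; apply/orP; left; apply/eqP; field.
by rewrite gt_eqF.
Qed.

End QuasiBanach.
End KFunctional.

(** * Norm estimates for the two spaces of the couple *)

(** With h = b0/a0, the function c0 is [a0 t * tail_norm r0 h t]; likewise c1 is
    [head_norm r1 b1]. *)
Definition tail_norm {R : realType} (q : \bar R) (h : R -> R) (t : R) : R :=
  fine (Lq q `]t, +oo[ (fun s => (s `^ (- recip q) * h s)%:E)).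

Definition head_norm {R : realType} (q : \bar R) (h : R -> R) (t : R) : R :=
  fine (Lq q `]0, t[ (fun s => (s `^ (- recip q) * h s)%:E)).

Section SpaceEstimates.
Context {R : realType} {V : lmodType R}.
Variables A0 A1 : @qspace R V.
Hypotheses (hA0 : quasi_banach A0) (hA1 : quasi_banach A1).

Local Notation lebT :=
  (caratheodory_type ((wlength (idfun : R -> R))^*)%mu).
Local Notation pos := (`]0, +oo[%classic : set R).
Local Notation K := (rK A0 A1).

Let A0fin := quasi_banach_finite hA0.
Let A1fin := quasi_banach_finite hA1.

Lemma powR_split (u p r : R) : 0 < u -> u `^ (p - r) = u `^ (- r) * expR (p * ln u).
Proof. by move=> u0; rewrite !powRE// -expRD; congr expR; ring. Qed.

Lemma weightE (u p r x : R) f : 0 < u -> sum_space A0 A1 f ->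
  ((u `^ (p - r) * x)%:E * Kfun A0 A1 u f)%E =
  (u `^ (- r) * (expR (p * ln u) * x * K u f))%:E.
Proof.
move=> u0 sf; rewrite KfunE ?(ltW u0)// powR_split// -EFinM.
by rewrite !mulrA.
Qed.

Lemma weighted_Kfun_ge0 (u p x : R) f : 0 < u -> 0 <= x ->
  (0 <= (u `^ p * x)%:E * Kfun A0 A1 u f)%E.
Proof.
by move=> u0 x0; rewrite mule_ge0 ?lee_fin ?mulr_ge0 ?powR_ge0 ?Kfun_ge0// ltW.
Qed.

(** Reduces the comparison of weight times slowly varying factor times K-functional to one linear
    inequality between exponents. *)
Lemma exp_bound (x y z w alpha k A N : R) : 0 <= alpha -> 0 <= k ->
  alpha <= A * expR y -> k <= N * expR z -> x + y + z <= w ->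
  expR x * alpha * k <= A * N * expR w.
Proof.
move=> al0 k0 hal hk hw.
have A0' : 0 <= A by rewrite -(pmulr_lge0 _ (expR_gt0 y)); exact: le_trans hal.
have N0 : 0 <= N by rewrite -(pmulr_lge0 _ (expR_gt0 z)); exact: le_trans hk.
apply: (@le_trans _ _ (expR x * (A * expR y) * (N * expR z))).
  by rewrite ler_pM ?mulr_ge0 ?expR_ge0// ler_wpM2l ?expR_ge0.
have -> : expR x * (A * expR y) * (N * expR z) = A * N * expR (x + y + z).
  by rewrite !expRD; ring.
by rewrite ler_wpM2l ?mulr_ge0// ler_expR.
Qed.

Lemma pos_gt0 (u : R) : pos u -> 0 < u.
Proof. by rewrite /= in_itv/= andbT. Qed.

Lemma measurable_peak (M e y : R) : measurable_fun (pos : set lebT)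
  ((fun u => M * expR (- (e * `|ln u - y|))) : lebT -> measurableTypeR R).
Proof.
have mf : measurable_fun [set: measurableTypeR R]
    (fun u => M * expR (- (e * `|ln u - y|))).
  apply: measurable_funM => //.
  apply: measurableT_comp => //; apply: measurableT_comp => //.
  apply: measurable_funM => //; apply: measurableT_comp => //.
  by apply: measurable_funB => //; exact: measurable_ln.
have mf' : measurable_fun [set: lebT]
    ((fun u => M * expR (- (e * `|ln u - y|))) : lebT -> measurableTypeR R).
  by move=> _ Y mY; apply: measurable_leb; exact: mf.
exact: (measurable_funS measurableT (@subsetT _ _) mf').
Qed.

(** * Estimates for the limiting space with parameter 1 *)

Section InterpK1.
Variables (r1 : \bar R) (b1 : R -> R).
Hypotheses (hr1 : (0 < r1)%E) (b1s : slow b1)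
  (mb1 : measurable_fun (pos : set lebT) (b1 : lebT -> measurableTypeR R))
  (c1fin : forall t, 0 < t ->
     Lq r1 `]0, t[ (fun s => (s `^ (- recip r1) * b1 s)%:E) = (head_norm r1 b1 t)%:E).

Local Notation Y1 := (interpK A0 A1 1 r1 b1).
Local Notation w1 := (fun s : R => (s `^ (- recip r1) * b1 s)%:E).

Lemma interpK1_finite : finite_norm Y1.
Proof. by move=> f [_ h]; rewrite h andbT; exact: Lq_ge0. Qed.

Let meas_w1 (t : R) : measurable_fun (`]0, t[%classic : set lebT) (w1 : lebT -> \bar R).
Proof.
apply: measurable_weight => // u /=.
by rewrite !in_itv/= andbT => /andP[].
Qed.

Let scale_w1 (t k : R) : 0 <= k -> 0 < t ->
  Lq r1 `]0, t[ (fun s => k%:E * w1 s)%E = (k * head_norm r1 b1 t)%:E.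
Proof.
move=> k0 t0; rewrite EFinM -c1fin//.
apply: (@Lnorm_patch_scale _ lebT R leb leb_setT_gt0);
  [exact: hr1| |exact: meas_w1|exact: k0].
by apply: measurable_leb; exact: measurable_itv.
Qed.

(** For u < t, K(u, f)/u >= K(t, f)/t; this constant factors out of the norm over (0, t). *)
Lemma interpK1_lower f t : carrier Y1 f -> 0 < t ->
  head_norm r1 b1 t * (K t f / t) <= rnorm Y1 f.
Proof.
move=> cf t0; have sf := cf.1.
rewrite -lee_fin -(rnormE interpK1_finite cf) /= mulrC -scale_w1//; last first.
  by rewrite divr_ge0 ?(ltW t0)// rK_ge0// ltW.
apply: le_Lq => // [u|u|u].
- rewrite /= in_itv/= => /andP[u0 _].
  rewrite -EFinM lee_fin mulr_ge0 ?divr_ge0 ?mulr_ge0 ?powR_ge0 ?rK_ge0 ?(ltW t0)//.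
  by rewrite (ltW (b1s.1 u u0)).
- by move=> /pos_gt0 u0; apply: weighted_Kfun_ge0 => //; rewrite ltW ?b1s.1.
rewrite /= !in_itv/= andbT => /andP[u0 ut]; split => //.
rewrite weightE// -EFinM lee_fin mulrCA ler_wpM2l ?powR_ge0//.
rewrite [leRHS]mulrAC ler_wpM2r ?(ltW (b1s.1 u u0))// mulN1r expRN lnK//.
rewrite ler_pdivrMr// mulrC mulrA.
exact: (rK_scale A0fin A1fin u0 (ltW ut) sf).
Qed.

(** Below t the integrand is at most N/t times the weight defining c1. Above t it decays with
    exponent gamma - 1, so it is a peak at t of height b1(t) N/t, and b1 is dominated by c1. *)
Lemma interpK1_upper (gamma : R) : gamma < 1 ->
  (exists2 C : R, 0 < C & forall t, 0 < t -> b1 t <= C * head_norm r1 b1 t) ->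
  exists2 C : R, 0 < C & forall g N t, sum_space A0 A1 g -> 0 <= N -> 0 < t ->
    (forall u, 0 < u -> u <= t -> K u g <= N * expR (ln u - ln t)) ->
    (forall u, t <= u -> K u g <= N * expR (gamma * (ln u - ln t))) ->
    (qnorm Y1 g <= (C * (N * (head_norm r1 b1 t / t)))%:E)%E.
Proof.
move=> gam1 [Cl Cl0 b1le].
(* Half of the available decay 1 - gamma pays for the variation of b1, the other half is the decay
   of the peak. *)
pose e := (1 - gamma) / 2; have e0 : 0 < e by rewrite /e; lra.
have [Cb Cb0 Hb] := slow_le b1s e0.
have [Cs Cs0 Hs] := @Lnorm_patch_split _ lebT R leb leb_setT_gt0 r1 hr1.
have [Cp Cp0 Hp] := Lq_peak_le hr1 e0.
exists (Cs * (1 + Cp * (Cb * Cl))) => [|g N t sg N0 t0 HK1 HK2].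
  by rewrite mulr_gt0// addr_gt0// !mulr_gt0.
have c0 : 0 <= head_norm r1 b1 t by exact: fine_ge0 (Lq_ge0 _ _ _).
pose F2 u := u `^ (- recip r1) * (Cb * b1 t * N / t * expR (- (e * `|ln u - ln t|))).
have M0 : 0 <= Cb * b1 t * N / t.
  by rewrite divr_ge0 ?mulr_ge0 ?(ltW Cb0) ?(ltW t0)// (ltW (b1s.1 t t0)).
have mpeak := measurable_peak (Cb * b1 t * N / t) e (ln t).
have F2pos u : `[t, +oo[%classic u -> 0 < u.
  by rewrite /= in_itv/= andbT; exact: lt_le_trans.
apply: (@le_trans _ _ (Cs%:E * (Lq r1 `]0%R, t[%classic (fun s => (N / t)%:E * w1 s) +
    Lq r1 `[t, +oo[%classic (fun u => (F2 u)%:E)))%E).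
  apply: Hs.
  - by apply: measurable_leb; exact: measurable_itv.
  - by apply: measurable_leb; exact: measurable_itv.
  - by apply: measurable_funeM; exact: meas_w1.
  - apply: measurable_weight => //.
    by move=> u /F2pos u0; rewrite /= in_itv/= u0.
  - by move=> u /pos_gt0 u0; apply: weighted_Kfun_ge0 => //; rewrite ltW ?b1s.1.
  move=> u /pos_gt0 u0; have b0 := b1s.1 u u0; rewrite weightE//.
  have [tu|ut] := leP t u; [right|left]; rewrite /= in_itv/= ?tu ?u0 ?ut; split => //.
    rewrite lee_fin /F2 ler_wpM2l ?powR_ge0//.
    have -> : Cb * b1 t * N / t * expR (- (e * `|ln u - ln t|)) =
        Cb * b1 t * N * expR (- ln t - e * `|ln u - ln t|).
      by rewrite expRD expRN lnK// mulrA.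
    apply: (exp_bound _ _ (Hb u t u0 t0) (HK2 u tu)); rewrite ?(ltW b0) ?rK_ge0 ?(ltW u0)//.
    have h : ln t <= ln u by rewrite ler_ln.
    have -> : `|ln u - ln t| = ln u - ln t by rewrite ger0_norm// subr_ge0.
    by rewrite /e; nra.
  rewrite -EFinM lee_fin [leRHS]mulrCA ler_wpM2l ?powR_ge0//.
  rewrite mulrAC ler_wpM2r ?(ltW b0)// mulN1r expRN lnK// mulrC.
  rewrite ler_pdivrMr//; apply: (le_trans (HK1 u u0 (ltW ut))).
  by rewrite expRB !lnK// mulrAC mulrA.
rewrite -(mulrA Cs) [in leRHS]EFinM lee_wpmul2l ?lee_fin ?(ltW Cs0)//.
rewrite scale_w1 ?divr_ge0 ?(ltW t0)//.
apply: (@le_trans _ _ ((N / t * head_norm r1 b1 t)%:E +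
    (Cp * (Cb * b1 t * N / t))%:E)%E).
  rewrite leeD2l//; apply: (Hp _ _ (ln t)) => // u /F2pos u0.
  by rewrite lee_fin /F2 mulr_ge0 ?powR_ge0// mulr_ge0 ?expR_ge0.
rewrite -EFinD lee_fin mulrDl mul1r lerD//.
  by rewrite le_eqVlt; apply/orP; left; apply/eqP; ring.
rewrite -!mulrA ler_wpM2l ?(ltW Cp0)// ler_wpM2l ?(ltW Cb0)//.
rewrite mulrCA [leRHS]mulrCA ler_wpM2l// mulrA ler_wpM2r ?invr_ge0 ?(ltW t0)//.
exact: b1le.
Qed.

End InterpK1.

(** * Estimates for the L-type space *)

Section InterpL.
Variables (theta0 : R) (r0 q0 : \bar R) (a0 b0 : R -> R).
Hypotheses (hth : 0 < theta0) (hr0 : (0 < r0)%E) (hq0 : (0 < q0)%E)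
  (a0s : slow a0) (b0s : slow b0).

Local Notation Y0 := (interpL A0 A1 theta0 r0 b0 q0 a0).
Local Notation h0 := (fun s : R => b0 s / a0 s).
Local Notation w0 := (fun s : R => (s `^ (- recip r0) * h0 s)%:E).

Hypotheses
  (mh0 : measurable_fun (pos : set lebT) (h0 : lebT -> measurableTypeR R))
  (Tfin : forall t, 0 < t -> Lq r0 `]t, +oo[ w0 = (tail_norm r0 h0 t)%:E).

Lemma interpL_finite : finite_norm Y0.
Proof. by move=> f [_ h]; rewrite h andbT; exact: Lq_ge0. Qed.

Let h0_gt0 s : 0 < s -> 0 < h0 s.
Proof. by move=> s0; rewrite divr_gt0 ?a0s.1 ?b0s.1. Qed.

Let itv_pos (t : R) : 0 < t -> `]t, +oo[%classic `<=` pos.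
Proof. by move=> t0 u /=; rewrite !in_itv/= !andbT; exact: lt_trans. Qed.

Let scale_w0 (t k : R) : 0 <= k -> 0 < t ->
  Lq r0 `]t, +oo[ (fun s => k%:E * w0 s)%E = (k * tail_norm r0 h0 t)%:E.
Proof.
move=> k0 t0; rewrite EFinM -Tfin//.
apply: (@Lnorm_patch_scale _ lebT R leb leb_setT_gt0); [exact: hr0| | |exact: k0].
  by apply: measurable_leb; exact: measurable_itv.
by apply: measurable_weight (itv_pos t0) mh0; exact: measurable_itv.
Qed.

Local Notation inner f s := (Lq q0 `]0%R, s[%classic
  (fun u => (u `^ (- theta0 - recip q0) * a0 u)%:E * Kfun A0 A1 u f)%E).

(** For every s > t the inner norm sees the interval from t/e to t, hence is at least a constant
    multiple of M, independent of s; the outer norm over (t, oo) then yields the tail norm. *)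
Lemma interpL_lower : exists2 C : R, 0 < C & forall f t, carrier Y0 f -> 0 < t ->
  a0 t * tail_norm r0 h0 t * t `^ (- theta0) * K t f <= C * rnorm Y0 f.
Proof.
have [Ca Ca0 Ha] := slow_le a0s ltr01.
have [C C0 HC] := Lq_ge_const hq0.
(* Over logarithmic distance 1 the factor a0 costs e and K costs e^2, whence [expR 3]. *)
have CC0 : 0 < Ca * expR 3 * C by rewrite !mulr_gt0 ?expR_gt0.
exists (Ca * expR 3 * C) => // f t cf t0; have sf := cf.1.
pose M := t `^ (- theta0) * a0 t * K t f.
have M0 : 0 <= M by rewrite !mulr_ge0 ?powR_ge0 ?rK_ge0 ?(ltW (a0s.1 t t0)) ?(ltW t0).
have innerM s : t < s -> ((M / (Ca * expR 3 * C))%:E <= inner f s)%E.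
  move=> ts.
  have -> : M / (Ca * expR 3 * C) = C^-1 * (M / (Ca * expR 3)).
    by field; rewrite !gt_eqF ?expR_gt0.
  rewrite EFinM lee_pdivrMl//; apply: (HC _ _ (ln t - 1)).
  - by rewrite divr_ge0// mulr_ge0 ?expR_ge0 ?ltW.
  - move=> u /=; rewrite in_itv/= => /andP[u0 _].
    by apply: weighted_Kfun_ge0 => //; rewrite ltW ?a0s.1.
  move=> u; rewrite subrK lnK// => /andP[h1 ut].
  have u0 : 0 < u by apply: lt_trans h1; exact: expR_gt0.
  split; first by rewrite /= in_itv/= u0/= (lt_trans ut).
  rewrite weightE// lee_fin ler_wpM2l ?powR_ge0//.
  rewrite ler_pdivrMr ?mulr_gt0 ?expR_gt0//.
  have l1 : ln t - 1 <= ln u by rewrite -ler_expR lnK// ltW.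
  have l2 : ln u <= ln t by rewrite ler_ln// ltW.
  have hK := rK_moderate A0fin A1fin sf t0 u0.
  have ha := Ha t u t0 u0.
  have -> : expR (- theta0 * ln u) * a0 u * K u f * (Ca * expR 3) =
     (Ca * a0 u) * K u f * expR (- theta0 * ln u + 3).
    by rewrite (expRD _ 3); ring.
  rewrite /M powRE//; apply: (exp_bound _ _ ha hK).
  - by rewrite ltW ?a0s.1.
  - by rewrite rK_ge0 ?ltW.
  have -> : `|ln t - ln u| = ln t - ln u by rewrite ger0_norm// subr_ge0.
  have hD : 0 <= theta0 * (ln t - ln u) by rewrite mulr_ge0 ?(ltW hth)// subr_ge0.
  lra.
have -> : a0 t * tail_norm r0 h0 t * t `^ (- theta0) * K t f = M * tail_norm r0 h0 t.
  by rewrite /M; ring.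
rewrite -ler_pdivrMl// mulrA [_^-1 * M]mulrC.
rewrite -lee_fin -(rnormE interpL_finite cf) -scale_w0//; last first.
  exact: divr_ge0 M0 (ltW CC0).
apply: le_Lq => // [s|s|s].
- move=> /(itv_pos t0)/pos_gt0 s0.
  rewrite -EFinM lee_fin; apply: mulr_ge0; first exact: divr_ge0 M0 (ltW CC0).
  exact: mulr_ge0 (powR_ge0 _ _) (ltW (h0_gt0 s0)).
- move=> /pos_gt0 s0; rewrite mule_ge0 ?Lq_ge0// lee_fin mulr_ge0 ?powR_ge0//.
  exact: ltW (h0_gt0 s0).
move=> ts; split; first exact: itv_pos ts.
have s0 := pos_gt0 (itv_pos t0 ts).
rewrite muleC; apply: lee_wpmul2l.
  by rewrite lee_fin; exact: mulr_ge0 (powR_ge0 _ _) (ltW (h0_gt0 s0)).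
by apply: innerM; move: ts; rewrite /= in_itv/= andbT.
Qed.

(** The inner integrand is a peak at min(s, t). For s <= t its height is proportional to a0(s),
    which cancels the denominator of b0/a0 and leaves an outer peak at t of height b0(t) N
    t^(-theta0). For s > t the height does not depend on s, and the outer norm is the tail norm. *)
Lemma interpL_upper (beta : R) : theta0 < beta ->
  (exists2 C : R, 0 < C & forall t, 0 < t -> h0 t <= C * tail_norm r0 h0 t) ->
  exists2 C : R, 0 < C & forall g N t, sum_space A0 A1 g -> 0 <= N -> 0 < t ->
    (forall u, 0 < u -> u <= t -> K u g <= N * expR (beta * (ln u - ln t))) ->
    (forall u, 0 < u -> K u g <= N) ->
    (qnorm Y0 g <= (C * (N * (a0 t * tail_norm r0 h0 t * t `^ (- theta0))))%:E)%E.
Proof.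
move=> thbe [Cl Cl0 h0le].
(* The powers grow with exponent beta - theta0 left of t and decay with exponent theta0 right of it;
   each must cover 2 * e, once for a0 or b0 and once for the peak. *)
pose e := Num.min theta0 (beta - theta0) / 2.
have e0 : 0 < e by rewrite divr_gt0// lt_min hth subr_gt0.
have e1 : 2 * e <= theta0 by rewrite mulrCA divff// mulr1 ge_min lexx.
have e2 : 2 * e <= beta - theta0 by rewrite mulrCA divff// mulr1 ge_min lexx orbT.
have [Ca Ca0 Ha] := slow_le a0s e0.
have [Cb Cb0 Hb] := slow_le b0s e0.
have [Cs Cs0 Hs] := @Lnorm_patch_split _ lebT R leb leb_setT_gt0 r0 hr0.
have [Cq Cq0 Hq] := Lq_peak_le hq0 e0.
have [Cp Cp0 Hp] := Lq_peak_le hr0 e0.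
exists (Cs * (Cp * (Cq * Ca * Cb * Cl) + Cq * Ca)) => [|g N t sg N0 t0 HK1 HK2].
  by rewrite mulr_gt0// addr_gt0// !mulr_gt0.
have T0 : 0 <= tail_norm r0 h0 t by exact: fine_ge0 (Lq_ge0 _ _ _).
have a0p u : 0 < u -> 0 <= a0 u by move=> u0; exact: ltW (a0s.1 u u0).
have b0p u : 0 < u -> 0 <= b0 u by move=> u0; exact: ltW (b0s.1 u u0).
have inner_le s (M : R) : 0 <= M -> (forall u, 0 < u -> u < s ->
    expR (- theta0 * ln u) * a0 u * K u g <= M * expR (- (e * `|ln u - ln (Num.min s t)|))) ->
    (inner g s <= (Cq * M)%:E)%E.
  move=> M0 hM; apply: (Hq _ _ (ln (Num.min s t))) => // u; rewrite /= in_itv/= => /andP[u0 us] //.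
    by apply: weighted_Kfun_ge0 => //; exact: a0p.
  by rewrite weightE// lee_fin ler_wpM2l ?powR_ge0// hM.
have inner1 s : 0 < s -> s <= t ->
    (inner g s <= (Cq * (Ca * a0 s * N *
       expR (- theta0 * ln s - beta * (ln t - ln s))))%:E)%E.
  move=> s0 st; apply: inner_le => [|u u0 us].
    by rewrite mulr_ge0 ?expR_ge0// !mulr_ge0 ?a0p// ltW.
  rewrite min_l// -[leRHS]mulrA -expRD.
  apply: (exp_bound _ _ (Ha u s u0 s0) (HK1 u u0 (le_trans (ltW us) st))).
  - exact: a0p.
  - by rewrite rK_ge0 ?ltW.
  have h : ln u <= ln s by rewrite ler_ln// ltW.
  have -> : `|ln u - ln s| = ln s - ln u by rewrite ler0_norm ?opprB// subr_le0.
  have : 0 <= (beta - theta0 - 2 * e) * (ln s - ln u) by rewrite mulr_ge0 ?subr_ge0//; lra.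
  lra.
have inner2 s : t < s ->
    (inner g s <= (Cq * (Ca * a0 t * N * expR (- theta0 * ln t)))%:E)%E.
  move=> ts; apply: inner_le => [|u u0 us].
    by rewrite mulr_ge0 ?expR_ge0// !mulr_ge0 ?a0p// ltW.
  rewrite min_r ?(ltW ts)// -[leRHS]mulrA -expRD.
  have [ut|tu] := leP u t.
    apply: (exp_bound _ _ (Ha u t u0 t0) (HK1 u u0 ut)).
    - exact: a0p.
    - by rewrite rK_ge0 ?ltW.
    have h : ln u <= ln t by rewrite ler_ln.
    have -> : `|ln u - ln t| = ln t - ln u by rewrite ler0_norm ?opprB// subr_le0.
    have : 0 <= (beta - theta0 - 2 * e) * (ln t - ln u) by rewrite mulr_ge0 ?subr_ge0//; lra.
    lra.
  have hK : K u g <= N * expR 0 by rewrite expR0 mulr1 HK2.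
  apply: (exp_bound _ _ (Ha u t u0 t0) hK).
  - exact: a0p.
  - by rewrite rK_ge0 ?ltW.
  have h : ln t <= ln u by rewrite ler_ln// ltW.
  have -> : `|ln u - ln t| = ln u - ln t by rewrite ger0_norm// subr_ge0.
  have : 0 <= (theta0 - 2 * e) * (ln u - ln t) by rewrite mulr_ge0 ?subr_ge0.
  lra.
pose M1 := Cq * Ca * Cb * b0 t * N * expR (- theta0 * ln t).
pose M2 := Cq * (Ca * a0 t * N * expR (- theta0 * ln t)).
have M10 : 0 <= M1 by rewrite mulr_ge0 ?expR_ge0// !mulr_ge0 ?b0p// ltW.
have M20 : 0 <= M2 by rewrite mulr_ge0 ?(ltW Cq0)// mulr_ge0 ?expR_ge0// !mulr_ge0 ?a0p// ltW.
pose F1 s := s `^ (- recip r0) * (M1 * expR (- (e * `|ln s - ln t|))).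
have D1pos : `]0, t]%classic `<=` pos.
  by move=> u /=; rewrite !in_itv/= andbT => /andP[].
apply: (@le_trans _ _ (Cs%:E * (Lq r0 `]0%R, t]%classic (fun s => (F1 s)%:E) +
    Lq r0 `]t, +oo[%classic (fun s => M2%:E * w0 s)))%E).
  apply: Hs.
  - by apply: measurable_leb; exact: measurable_itv.
  - by apply: measurable_leb; exact: measurable_itv.
  - apply: measurable_weight; [exact: measurable_itv|exact: D1pos|].
    exact: measurable_peak.
  - apply: measurable_funeM.
    by apply: measurable_weight => //; exact: itv_pos.
  - move=> s /pos_gt0 s0; rewrite mule_ge0 ?Lq_ge0// lee_fin.
    exact: mulr_ge0 (powR_ge0 _ _) (ltW (h0_gt0 s0)).
  move=> s /pos_gt0 s0.
  have ws0 : (0 <= w0 s)%E.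
    by rewrite lee_fin; exact: mulr_ge0 (powR_ge0 _ _) (ltW (h0_gt0 s0)).
  have [st|ts] := leP s t; [left|right]; rewrite /= in_itv/= ?s0 ?st ?ts; split => //.
    apply: (le_trans (lee_wpmul2l ws0 (inner1 s s0 st))).
    rewrite -EFinM lee_fin /F1 -(mulrA (s `^ _)) ler_wpM2l ?powR_ge0//.
    have -> : b0 s / a0 s * (Cq * (Ca * a0 s * N * expR (- theta0 * ln s - beta * (ln t - ln s)))) =
       expR (- theta0 * ln s - beta * (ln t - ln s)) * b0 s * (Cq * Ca * N).
      by field; rewrite gt_eqF ?a0s.1.
    have -> : M1 * expR (- (e * `|ln s - ln t|)) =
       Cb * b0 t * (Cq * Ca * N) * expR (- theta0 * ln t - e * `|ln s - ln t|).
      by rewrite /M1 expRD; ring.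
    have hN : Cq * Ca * N <= Cq * Ca * N * expR 0 by rewrite expR0 mulr1.
    apply: (exp_bound _ _ (Hb s t s0 t0) hN).
    - exact: b0p.
    - by rewrite !mulr_ge0// ltW.
    have h : ln s <= ln t by rewrite ler_ln.
    have -> : `|ln s - ln t| = ln t - ln s by rewrite ler0_norm ?opprB// subr_le0.
    have : 0 <= (beta - theta0 - 2 * e) * (ln t - ln s) by rewrite mulr_ge0 ?subr_ge0//; lra.
    lra.
  by rewrite [leRHS]muleC; apply: lee_wpmul2l => //; exact: inner2.
rewrite scale_w0//.
have peak : (Lq r0 `]0%R, t]%classic (fun s => (F1 s)%:E) <= (Cp * M1)%:E)%E.
  apply: (Hp _ _ (ln t)) => // u /D1pos/pos_gt0 u0 //.
  by rewrite lee_fin /F1 mulr_ge0 ?powR_ge0// mulr_ge0 ?expR_ge0.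
apply: (le_trans (lee_wpmul2l _ (leeD2r _ peak))); first by rewrite lee_fin ltW.
rewrite -EFinD -EFinM lee_fin -!(mulrA Cs) ler_wpM2l ?(ltW Cs0)// mulrDl lerD//.
  rewrite -(mulrA Cp) ler_wpM2l ?(ltW Cp0)// /M1 powRE//.
  (* Here the peak left of t is absorbed into c0. *)
  have b0le : b0 t <= Cl * (a0 t * tail_norm r0 h0 t).
    have := h0le t t0; rewrite ler_pdivrMr ?a0s.1// => /le_trans; apply.
    by rewrite le_eqVlt; apply/orP; left; apply/eqP; ring.
  have -> : Cq * Ca * Cb * Cl * (N * (a0 t * tail_norm r0 h0 t * expR (- theta0 * ln t))) =
     Cq * Ca * Cb * (Cl * (a0 t * tail_norm r0 h0 t)) * N * expR (- theta0 * ln t) by ring.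
  by rewrite ler_wpM2r ?expR_ge0// ler_wpM2r// ler_wpM2l// !mulr_ge0// ltW.
rewrite /M2 powRE// le_eqVlt; apply/orP; left; apply/eqP; ring.
Qed.

End InterpL.
End SpaceEstimates.

(** * The change of variable rho *)

Section Moderate.
Context {R : realType}.

Lemma moderate_weaken (N N' : R) (phi : R -> R) : N <= N' ->
  (forall u, 0 < u -> 0 <= phi u) -> moderate N phi -> moderate N' phi.
Proof.
move=> NN' phi0 mphi u v u0 v0; apply: (le_trans (mphi u v u0 v0)).
by rewrite ler_wpM2l ?phi0// ler_expR ler_wpM2r// addr_ge0.
Qed.

(** N is chosen before k, so one N serves all elements f. *)
Lemma moderate_weight (p : R) (b : R -> R) : slow b -> exists2 N : R, 0 <= N &
  forall k : R -> R, (forall u, 0 < u -> 0 <= k u) -> moderate 1 k ->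
    moderate N (fun u => expR (- p * ln u) * b u * k u).
Proof.
move=> bs; have [C C0 H] := slow_le bs ltr01.
exists (`|p| + 2 + `|ln C|) => [|k k0 mk u v u0 v0]; first by rewrite !addr_ge0.
have hb := H u v u0 v0; have hk := mk u v u0 v0.
have D0 := normr_ge0 (ln u - ln v); set D := `|ln u - ln v| in hb hk D0 *.
have -> : expR (- p * ln v) * b v * k v * expR ((`|p| + 2 + `|ln C|) * (1 + D)) =
    b v * k v * expR (- p * ln v + (`|p| + 2 + `|ln C|) * (1 + D)).
  by rewrite expRD; ring.
have hb' : b u <= b v * expR (ln C + 1 * D).
  by rewrite expRD lnK// mulrA (mulrC (b v)).
apply: (exp_bound _ _ hb' hk).
- exact: ltW (bs.1 u u0).
- exact: k0.
have h1 : - (p * (ln u - ln v)) <= `|p| * D.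
  by rewrite /D -normrM -normrN ler_norm.
have h2 := ler_norm (ln C); have h3 := normr_ge0 p.
have h4 : 0 <= `|ln C| * D by rewrite mulr_ge0.
have h5 : 0 <= `|p| by [].
lra.
Qed.

End Moderate.

Section ChangeOfVariable.
Context {R : realType}.
Variables (m : R) (g : R -> R).
Hypotheses (m0 : 0 < m) (gs : slow g).

Local Notation rho := (fun t : R => t `^ m * g t).

Lemma rho_gt0 t : 0 < t -> 0 < rho t.
Proof. by move=> t0; rewrite mulr_gt0 ?powR_gt0 ?gs.1. Qed.

Lemma ln_rho t : 0 < t -> ln (rho t) = m * ln t + ln (g t).
Proof. by move=> t0; rewrite lnM ?posrE ?powR_gt0 ?gs.1// ln_powR. Qed.

(** Slow variation of g is used with exponent m/2, so increments of ln rho keep between m/2 and 3m/2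
    times those of ln t, up to c. *)
Lemma rho_diff : exists c : R, forall s t, 0 < s -> 0 < t ->
  `|ln (rho s) - ln (rho t) - m * (ln s - ln t)| <= m / 2 * `|ln s - ln t| + c.
Proof.
have [c H] := gs.2 _ (divr_gt0 m0 (ltr0Sn R 1)); exists c => s t s0 t0.
rewrite !ln_rho// ler_norml; have := H s t s0 t0; have := H t s t0 s0.
by rewrite (distrC (ln t)); lra.
Qed.

Lemma rho_upper : exists c : R, forall s t, 0 < s -> 0 < t ->
  `|ln (rho s) - ln (rho t)| <= 2 * m * `|ln s - ln t| + c.
Proof.
have [c H] := rho_diff; exists c => s t s0 t0; have := H s t s0 t0.
have D0 := normr_ge0 (ln s - ln t).
have : `|m * (ln s - ln t)| = m * `|ln s - ln t| by rewrite normrM (gtr0_norm m0).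
have : 0 <= m * `|ln s - ln t| by rewrite mulr_ge0// ltW.
have := ler_normD (ln (rho s) - ln (rho t) - m * (ln s - ln t)) (m * (ln s - ln t)).
rewrite subrK; lra.
Qed.

Lemma rho_separated : exists c : R, forall s t, 0 < s -> 0 < t ->
  m / 2 * `|ln s - ln t| - c <= `|ln (rho s) - ln (rho t)|.
Proof.
have [c H] := rho_diff; exists c => s t s0 t0; have := H s t s0 t0.
have : `|m * (ln s - ln t)| = m * `|ln s - ln t| by rewrite normrM (gtr0_norm m0).
have := ler_distD (ln (rho s) - ln (rho t)) (m * (ln s - ln t)) 0.
rewrite !subr0 (distrC (m * _)); lra.
Qed.

(** An inverse up to a bounded factor, found by a supremum in place of the intermediate value
    theorem, as g need not be continuous. *)
Lemma rho_inverse : exists (sigma : R -> R) (c : R), forall u, 0 < u ->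
  0 < sigma u /\ `|ln (rho (sigma u)) - ln u| <= c.
Proof.
have [c H] := rho_diff.
pose P x := ln (rho (expR x)).
have HP x y : `|P x - P y - m * (x - y)| <= m / 2 * `|x - y| + c.
  by have := H _ _ (expR_gt0 x) (expR_gt0 y); rewrite !expRK.
suff [sigma Hs] : exists sigma : R -> R, forall u, `|P (sigma u) - ln u| <= 3 * m + c.
  exists (fun u => expR (sigma u)), (3 * m + c) => u u0.
  by split; [exact: expR_gt0|exact: Hs].
suff : forall u, exists x, `|P x - ln u| <= 3 * m + c.
  by move=> /choice[f Hf]; exists f.
move=> u; set y := ln u; pose S := [set x | P x <= y].
(* Increments of P have slope at least m/2 up to c, so -L lies in S and L' bounds S from above. *)
pose L := 2 / m * `|P 0 + c - y|.
have L0 : 0 <= L by rewrite mulr_ge0// divr_ge0// ltW.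
pose L' := 2 / m * `|y - P 0 + c|.
have L'0 : 0 <= L' by rewrite mulr_ge0// divr_ge0// ltW.
have mL : m / 2 * L = `|P 0 + c - y| by rewrite /L; field; rewrite gt_eqF.
have mL' : m / 2 * L' = `|y - P 0 + c| by rewrite /L'; field; rewrite gt_eqF.
have hS : has_sup S.
  split.
    exists (- L); rewrite /S /=; have := HP (- L) 0.
    rewrite subr0 normrN (ger0_norm L0) ler_norml mL => /andP[_ h].
    have := ler_norm (P 0 + c - y); have : m * L = 2 * (m / 2 * L) by field.
    by rewrite mL; lra.
  exists L' => x; rewrite /S /= => Px; have [x0|x0] := leP x 0; first exact: le_trans L'0.
  have := HP x 0; rewrite subr0 (gtr0_norm x0) ler_norml => /andP[h _].
  have h2 := ler_norm (y - P 0 + c).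
  have : m / 2 * x <= m / 2 * L' by rewrite mL'; lra.
  by rewrite ler_pM2l// divr_gt0.
have [x1 Sx1 lt1] := sup_adherent ltr01 hS.
have ubS x : S x -> x <= sup S by move: x; exact: ub_le_sup hS.2.
have le1 := ubS _ Sx1.
have lt2 : y < P (sup S + 1).
  rewrite ltNge; apply/negP => h.
  by have := ubS _ h; rewrite gerDl ler10.
(* P passes y between x1 and sup S + 1, less than 2 apart; the increment is at most 2 * m + m +
   c. *)
exists x1; have := HP (sup S + 1) x1.
have D0 : 0 <= sup S + 1 - x1 by lra.
rewrite (ger0_norm D0) ler_norml => /andP[_ h].
have : m * (sup S + 1 - x1) <= m * 2 by rewrite ler_pM2l//; lra.
rewrite /S /= in Sx1; rewrite ler_norml; lra.
Qed.

End ChangeOfVariable.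

(** * Reiteration *)

Lemma measurable_SV_div {R : realType} (b c : R -> R) : SV b -> SV c ->
  measurable_fun (`]0, +oo[ : set (caratheodory_type ((wlength (idfun : R -> R))^*)%mu))
    ((fun s => b s / c s) :
      caratheodory_type ((wlength (idfun : R -> R))^*)%mu -> measurableTypeR R).
Proof.
move=> [_ mb _] [c0 mc _]; apply: (measurable_funM mb).
have := measurableT_comp (@measurable_powR R (-1)) mc.
apply: eq_measurable_fun => s /[!inE]/pos_gt0 s0.
by rewrite /= powR_inv1// ltW// c0.
Qed.

Section InterpKNorm.
Context {R : realType} {V : lmodType R}.
Variables X0 X1 : @qspace R V.
Hypotheses (X0fin : finite_norm X0) (X1fin : finite_norm X1).

Lemma interpK_normE theta q b (f : V) : sum_space X0 X1 f ->
  interpK_norm X0 X1 theta q b f = Lq q `]0, +oo[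
    (fun u : R => (u `^ (- recip q) *
       (expR (- theta * ln u) * b u * rK X0 X1 u f))%:E).
Proof.
move=> sf; rewrite /interpK_norm /Lq; congr Lnorm; apply/funext => u.
rewrite /patch; case: ifPn => // /[!inE]/pos_gt0 u0.
by rewrite KfunE ?(ltW u0)// powR_split// -EFinM !mulrA.
Qed.

End InterpKNorm.

Section Reiteration.
Context {R : realType} {V : lmodType R}.
Variables (A0 A1 : @qspace R V) (theta theta0 : R) (q0 r0 r1 r : \bar R).
Variables (a a0 b0 b1 : R -> R).
Hypotheses (hA0 : quasi_banach A0) (hA1 : quasi_banach A1).
Hypotheses (htheta : 0 < theta < 1) (htheta0 : 0 < theta0 < 1).
Hypotheses (hq0 : (0 < q0)%E) (hr0 : (0 < r0)%E) (hr1 : (0 < r1)%E) (hr : (0 < r)%E).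
Hypotheses (sa : slow a) (sa0 : slow a0) (sb0 : slow b0) (sb1 : slow b1).

Local Notation lebT :=
  (caratheodory_type ((wlength (idfun : R -> R))^*)%mu).
Local Notation pos := (`]0, +oo[%classic : set R).
Local Notation h0 := (fun s : R => b0 s / a0 s).

Hypotheses
  (mh0 : measurable_fun (pos : set lebT) (h0 : lebT -> measurableTypeR R))
  (mb1 : measurable_fun (pos : set lebT) (b1 : lebT -> measurableTypeR R)).
Hypotheses
  (hfin0 : (Lq r0 `]1%R, +oo[ (fun s => (s `^ (- recip r0) * h0 s)%:E) < +oo)%E)
  (hfin1 : (Lq r1 `]0%R, 1%R[ (fun s => (s `^ (- recip r1) * b1 s)%:E) < +oo)%E).

Local Notation c0 := (fun t : R => a0 t * tail_norm r0 h0 t).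
Local Notation c1 := (head_norm r1 b1).
Local Notation rho := (fun t : R => t `^ (1 - theta0) * (c0 t / c1 t)).
Local Notation eta := ((1 - theta) * theta0 + theta).
Local Notation asharp := (fun t : R => c0 t `^ (1 - theta) * c1 t `^ theta * a (rho t)).
Local Notation Y0 := (interpL A0 A1 theta0 r0 b0 q0 a0).
Local Notation Y1 := (interpK A0 A1 1 r1 b1).
Local Notation K := (rK A0 A1).
Local Notation KY := (rK Y0 Y1).
Local Notation phiA f := (fun u => expR (- eta * ln u) * asharp u * K u f).
Local Notation phiY f := (fun u => expR (- theta * ln u) * a u * KY u f).

Let A0fin := quasi_banach_finite hA0.
Let A1fin := quasi_banach_finite hA1.

Let tailP := @tail_slow _ _ _ hr0 (slowM sb0 (slowV sa0)) mh0 hfin0.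
Let headP := @head_slow _ _ _ hr1 sb1 mb1 hfin1.

Let Tfin t : 0 < t -> Lq r0 `]t, +oo[ (fun s => (s `^ (- recip r0) * h0 s)%:E) =
  (tail_norm r0 h0 t)%:E.
Proof. by case: tailP => H _ _; exact: H. Qed.

Let c1fin t : 0 < t -> Lq r1 `]0, t[ (fun s => (s `^ (- recip r1) * b1 s)%:E) =
  (c1 t)%:E.
Proof. by case: headP => H _ _; exact: H. Qed.

Let sc0 : slow c0. Proof. by case: tailP => _ H _; exact: (slowM sa0 H). Qed.
Let sc1 : slow c1. Proof. by case: headP => _ H _; exact: H. Qed.
Let sg : slow (fun t => c0 t / c1 t). Proof. exact: slowM sc0 (slowV sc1). Qed.

Let m0 : 0 < 1 - theta0. Proof. by case/andP: htheta0; lra. Qed.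

Let rho0 t : 0 < t -> 0 < rho t. Proof. by move=> t0; exact: (rho_gt0 _ sg t0). Qed.

Let sasharp : slow asharp.
Proof.
apply: slowM; first by apply: slowM; exact: slow_powR.
have [c Hc] := rho_upper m0 sg.
by apply: slow_comp Hc => //; rewrite mulr_gt0.
Qed.

Let Y0fin : finite_norm Y0. Proof. exact: interpL_finite. Qed.
Let Y1fin : finite_norm Y1. Proof. exact: interpK1_finite. Qed.

Let c0_gt0 t : 0 < t -> 0 < c0 t. Proof. exact: sc0.1. Qed.
Let c1_gt0 t : 0 < t -> 0 < c1 t. Proof. exact: sc1.1. Qed.

(** The identity that dictates eta and asharp: the weight of the target space at t is that of the
    new couple at rho(t) times c0(t) t^(-theta0). *)
Let weight_rho t : 0 < t -> expR (- eta * ln t) * asharp t =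
  expR (- theta * ln (rho t)) * a (rho t) * (c0 t * expR (- theta0 * ln t)).
Proof.
move=> t0; have C0 := c0_gt0 t0; have C1 := c1_gt0 t0; have P0 := rho0 t0.
have -> : ln (rho t) = (1 - theta0) * ln t + (ln (c0 t) - ln (c1 t)).
  by rewrite (ln_rho _ sg t0) ln_div.
have -> : c0 t * expR (- theta0 * ln t) = expR (ln (c0 t) - theta0 * ln t).
  by rewrite expRD lnK// mulNr.
rewrite (powRE _ C0) (powRE _ C1).
set l0 := ln (c0 t); set l1 := ln (c1 t); set A := a (rho t).
have -> : expR (- eta * ln t) * (expR ((1 - theta) * l0) * expR (theta * l1) * A) =
   expR (- eta * ln t + (1 - theta) * l0 + theta * l1) * A.
  by rewrite !expRD; ring.
rewrite [RHS]mulrAC -expRD; congr (expR _ * A); ring.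
Qed.

(** At rho(t) the normalisations of the estimates in Y0 and Y1 agree; this is the origin of rho. *)
Let rhoE t : 0 < t -> rho t * (c1 t / t) = c0 t * expR (- theta0 * ln t).
Proof.
move=> t0; cbv beta; rewrite powRE// mulrBl mul1r expRD lnK// mulNr.
by field; rewrite !gt_eqF ?c1_gt0.
Qed.

Let sumY_sumA f : sum_space Y0 Y1 f -> sum_space A0 A1 f.
Proof.
by move=> [f0 cf0 [f1 cf1 <-]]; apply: (sum_space_add hA0 hA1); [exact: cf0.1|exact: cf1.1].
Qed.

Let phiA_le_phiY : exists2 C : R, 0 < C & forall f t, sum_space Y0 Y1 f -> 0 < t ->
  phiA f t <= C * phiY f (rho t).
Proof.
have [Ct Ct0 HKt] := rK_quasi_triangle hA0 hA1.
have th0 : 0 < theta0 by case/andP: htheta0.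
have [Cl Cl0 HL] := interpL_lower hA0 hA1 th0 hr0 hq0 sa0 sb0 mh0 Tfin.
exists (Ct * (Cl + 1)) => [|f t sf t0]; first by rewrite mulr_gt0// addr_gt0.
have C0 := c0_gt0 t0; have C1 := c1_gt0 t0; have P0 := rho0 t0.
set W := c0 t * expR (- theta0 * ln t).
have W0 : 0 < W by rewrite mulr_gt0 ?expR_gt0.
suff HK : W * K t f <= Ct * (Cl + 1) * KY (rho t) f.
  rewrite weight_rho// -/W -mulrA [leRHS]mulrCA.
  by rewrite ler_wpM2l// mulr_ge0 ?expR_ge0 ?(ltW (sa.1 _ P0)).
have CC0 : 0 < Ct * (Cl + 1) by rewrite mulr_gt0// addr_gt0.
apply/ler_addgt0Pr => e e0.
have [f0 [f1 [cf0 cf1 fE le]]] :=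
  rK_approx Y0fin Y1fin (ltW P0) (divr_gt0 e0 CC0) sf.
have -> : Ct * (Cl + 1) * KY (rho t) f + e =
   Ct * (Cl + 1) * (KY (rho t) f + e / (Ct * (Cl + 1))).
  by field; rewrite !gt_eqF// addr_gt0.
apply: le_trans (ler_wpM2l (ltW CC0) le).
have L0 := HL f0 t cf0 t0.
have L1 := interpK1_lower hA0 hA1 hr1 sb1 mb1 c1fin cf1 t0.
have n0 : 0 <= rnorm Y0 f0 by exact: rnorm_ge0.
have n1 : 0 <= rnorm Y1 f1 by exact: rnorm_ge0.
rewrite powRE// -/W in L0.
have L1' : W * K t f1 <= rho t * rnorm Y1 f1.
  rewrite /W -rhoE// -mulrA ler_wpM2l ?(ltW P0)//.
  by rewrite mulrAC -mulrA.
rewrite fE -(mulrA Ct).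
apply: (le_trans (ler_wpM2l (ltW W0) (HKt t f0 f1 (ltW t0) cf0.1 cf1.1))).
rewrite (mulrCA W) ler_wpM2l ?(ltW Ct0)// mulrDr.
have h1 : 0 <= Cl * (rho t * rnorm Y1 f1) by exact: mulr_ge0 (ltW Cl0) (mulr_ge0 (ltW P0) n1).
lra.
Qed.

(* The Holmstedt-type upper estimate: [f0] and [f1] split [f] near-optimally at
   [t], and the growth of [K(u, f)] allowed by the hypothesis is inherited. *)
Let phiY_le_phiA : exists delta C : R, [/\ 0 < delta, 0 < C &
  forall f t B, sum_space A0 A1 f -> 0 < t -> 0 < B ->
    (forall u, 0 < u -> phiA f u <= B * expR (delta * `|ln u - ln t|)) ->
    sum_space Y0 Y1 f /\ phiY f (rho t) <= C * B].
Proof.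
have [Ct Ct0 HKt] := rK_quasi_triangle hA0 hA1.
have th0 : 0 < theta0 by case/andP: htheta0.
have th1 : theta0 < 1 by case/andP: htheta0.
have t0' : 0 < theta by case/andP: htheta.
have t1' : theta < 1 by case/andP: htheta.
(* These are the gaps eta - theta0 and 1 - eta. A quarter of the smaller one leaves room for 2 * d
   on either side: one d from the hypothesis on phiA, one from the variation of 1/asharp. *)
pose al := theta * (1 - theta0); pose be := (1 - theta) * (1 - theta0).
have al0 : 0 < al by rewrite mulr_gt0 ?subr_gt0.
have be0 : 0 < be by rewrite mulr_gt0 ?subr_gt0.
have etaE : eta = theta0 + al by rewrite /al; ring.
have eta1 : eta = 1 - be by rewrite /be; ring.
pose d := Num.min al be / 4.
have d0 : 0 < d by rewrite divr_gt0// lt_min al0.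
have dal : 4 * d <= al by rewrite mulrCA divff// mulr1 ge_min lexx.
have dbe : 4 * d <= be by rewrite mulrCA divff// mulr1 ge_min lexx orbT.
have b1le : theta0 < eta - 2 * d by rewrite etaE; lra.
have g1le : eta + 2 * d < 1 by rewrite eta1; lra.
have [CT CT0 HT] : exists2 C : R, 0 < C &
    forall t, 0 < t -> h0 t <= C * tail_norm r0 h0 t by case: tailP.
have [CH CH0 HH] : exists2 C : R, 0 < C & forall t, 0 < t -> b1 t <= C * c1 t.
  by case: headP.
have [CU CU0 HU] := interpL_upper hA0 hA1 th0 hr0 hq0 sa0 sb0 mh0 Tfin b1le
  (ex_intro2 _ _ CT CT0 HT).
have [CV CV0 HV] := interpK1_upper hA0 hA1 hr1 sb1 mb1 c1fin g1le
  (ex_intro2 _ _ CH CH0 HH).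
have [Cs Cs0 Hs] := slow_le (slowV sasharp) d0.
(* In the quasi-triangle inequality f contributes Cs and the other summand 2; the last 2 covers the
   direct bounds by the norms of f0 and f1. *)
pose Cn := Ct * (Cs + 2) + 2.
have Cn0 : 0 < Cn by rewrite addr_gt0// mulr_gt0// addr_gt0.
exists d, ((CU + CV) * Cn); split => //; first by rewrite mulr_gt0// addr_gt0.
move=> f t B sf tp B0 hB.
have P0 := rho0 tp; have C0 := c0_gt0 tp; have C1 := c1_gt0 tp.
have [At AtE] : exists x, x = asharp t by exists (asharp t).
have As0 : 0 < At by rewrite AtE; exact: (sasharp.1 t tp).
(* The bound on K(t, f) given by the hypothesis at u = t. It is also the error allowed in the
   splitting, so the two norms add up to at most 2 * N1. *)
pose N1 := B * expR (eta * ln t) / At.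
have N10 : 0 < N1 by rewrite divr_gt0// mulr_gt0 ?expR_gt0.
have HK u : 0 < u ->
    K u f <= Cs * N1 * expR (eta * (ln u - ln t) + 2 * d * `|ln u - ln t|).
  move=> u0; have Au0 := sasharp.1 u u0.
  have h1 : K u f <= B * expR (d * `|ln u - ln t|) * (expR (eta * ln u) * (asharp u)^-1).
    have := hB u u0; rewrite mulNr expRN -mulrA ler_pdivrMl ?expR_gt0//.
    by rewrite mulrC -ler_pdivlMr// mulrAC mulrA mulrC mulrA; rewrite mulrC !mulrA.
  apply: (le_trans h1).
  have h2 : (asharp u)^-1 <= Cs * At^-1 * expR (d * `|ln u - ln t|).
    by rewrite AtE; exact: Hs.
  have h3 : 0 <= B * expR (d * `|ln u - ln t|) * expR (eta * ln u).
    by rewrite mulr_ge0 ?expR_ge0// mulr_ge0 ?expR_ge0// ltW.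
  rewrite [leLHS]mulrA; apply: (le_trans (ler_wpM2l h3 h2)).
  rewrite le_eqVlt; apply/orP; left; apply/eqP; rewrite /N1.
  have -> : eta * (ln u - ln t) + 2 * d * `|ln u - ln t| =
    eta * ln u + d * `|ln u - ln t| + d * `|ln u - ln t| - eta * ln t by ring.
  rewrite expRD expRN !expRD; field.
  by rewrite !gt_eqF ?expR_gt0.
have HKt0 : K t f <= N1.
  have := hB t tp; cbv beta; rewrite -AtE subrr normr0 mulr0 expR0 mulr1.
  rewrite mulNr expRN -mulrA ler_pdivrMl ?expR_gt0//.
  by rewrite mulrC -ler_pdivlMr// (mulrC (expR _)).
have [f0 [f1 [cf0 cf1 fE le]]] := rK_approx A0fin A1fin (ltW tp) N10 sf.
have n0 : 0 <= rnorm A0 f0 by exact: rnorm_ge0.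
have n1 : 0 <= rnorm A1 f1 by exact: rnorm_ge0.
have n1t : 0 <= t * rnorm A1 f1 by rewrite mulr_ge0// ltW.
have N2 : 0 <= 2 * N1 by rewrite mulr_ge0// ltW.
have n0le : rnorm A0 f0 <= 2 * N1 by lra.
have n1le : rnorm A1 f1 <= 2 * N1 / t by rewrite ler_pdivlMr// mulrC; lra.
have s0 := carrier_sum0 hA1 cf0; have s1 := carrier_sum1 hA0 cf1.
have K0le u : 0 < u -> K u f0 <= 2 * N1.
  by move=> u0; apply: le_trans n0le; exact: rK_le0 (ltW u0) cf0.
have K1le u : 0 < u -> K u f1 <= 2 * N1 * expR (ln u - ln t).
  move=> u0; apply: (le_trans (rK_le1 hA0 hA1 (ltW u0) cf1)).
  rewrite expRB !lnK//.
  have -> : 2 * N1 * (u / t) = u * (2 * N1 / t) by ring.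
  by rewrite ler_wpM2l// ltW.
have CnN : 0 <= Cn * N1 by rewrite mulr_ge0// ltW.
have le2 : 2 * N1 <= Cn * N1.
  by rewrite ler_wpM2r ?(ltW N10)// lerDr mulr_ge0 ?(ltW Ct0)// addr_ge0// ltW.
(* Below t, f0 is seen as f - f1: K(u, f1) is of order u/t, smaller than the power eta - 2 d < 1.
   Above t, symmetrically, f1 = f - f0 and K(u, f0) is bounded. *)
have HKf0 u : 0 < u -> u <= t -> K u f0 <= Cn * N1 * expR ((eta - 2 * d) * (ln u - ln t)).
  move=> u0 ut; have lut : ln u <= ln t by rewrite ler_ln.
  have -> : f0 = f + (- f1) by rewrite fE addrK.
  have cN : carrier A1 (- f1) by exact: carrierN.
  apply: (le_trans (HKt u f (- f1) (ltW u0) sf (carrier_sum1 hA0 cN))).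
  have h1 : K u (- f1) <= 2 * N1 * expR ((eta - 2 * d) * (ln u - ln t)).
    apply: (@le_trans _ _ (2 * N1 * expR (ln u - ln t))).
      apply: (le_trans (rK_le1 hA0 hA1 (ltW u0) cN)); rewrite rnormN//.
      rewrite expRB !lnK//.
      have -> : 2 * N1 * (u / t) = u * (2 * N1 / t) by ring.
      by rewrite ler_wpM2l// ltW.
    rewrite ler_wpM2l// ler_expR.
    have hd : 0 <= 1 - (eta - 2 * d) by lra.
    rewrite -subr_ge0 in lut.
    by have := mulr_ge0 hd lut; lra.
  have h2 : K u f <= Cs * N1 * expR ((eta - 2 * d) * (ln u - ln t)).
    apply: (le_trans (HK u u0)).
    have -> : `|ln u - ln t| = ln t - ln u by rewrite ler0_norm ?opprB// subr_le0.
    rewrite le_eqVlt; apply/orP; left; apply/eqP; congr (_ * expR _); ring.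
  apply: (le_trans (ler_wpM2l (ltW Ct0) (lerD h2 h1))).
  rewrite -mulrDl mulrA ler_wpM2r ?expR_ge0//.
  have -> : Ct * (Cs * N1 + 2 * N1) = Ct * (Cs + 2) * N1 by ring.
  by rewrite ler_wpM2r ?(ltW N10)// lerDl.
have HKf1 u : t <= u -> K u f1 <= Cn * N1 * expR ((eta + 2 * d) * (ln u - ln t)).
  move=> tu; have u0 : 0 < u by exact: lt_le_trans tu.
  have ltu : ln t <= ln u by rewrite ler_ln.
  have -> : f1 = f + (- f0) by rewrite fE addrC addKr.
  have cN : carrier A0 (- f0) by exact: carrierN.
  apply: (le_trans (HKt u f (- f0) (ltW u0) sf (carrier_sum0 hA1 cN))).
  have eta0 : 0 <= (eta + 2 * d) * (ln u - ln t).
    by rewrite mulr_ge0 ?subr_ge0// etaE; lra.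
  have h1 : K u (- f0) <= 2 * N1 * expR ((eta + 2 * d) * (ln u - ln t)).
    apply: (le_trans (rK_le0 hA0 hA1 (ltW u0) cN)); rewrite rnormN//.
    apply: (le_trans n0le); rewrite ler_peMr//.
    by rewrite -[leLHS]expR0 ler_expR.
  have h2 : K u f <= Cs * N1 * expR ((eta + 2 * d) * (ln u - ln t)).
    apply: (le_trans (HK u u0)).
    have -> : `|ln u - ln t| = ln u - ln t by rewrite ger0_norm// subr_ge0.
    rewrite le_eqVlt; apply/orP; left; apply/eqP; congr (_ * expR _); ring.
  apply: (le_trans (ler_wpM2l (ltW Ct0) (lerD h2 h1))).
  rewrite -mulrDl mulrA ler_wpM2r ?expR_ge0//.
  have -> : Ct * (Cs * N1 + 2 * N1) = Ct * (Cs + 2) * N1 by ring.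
  by rewrite ler_wpM2r ?(ltW N10)// lerDl.
have HK0 u : 0 < u -> K u f0 <= Cn * N1.
  by move=> u0; exact: le_trans (K0le u u0) le2.
have HK1 u : 0 < u -> u <= t -> K u f1 <= Cn * N1 * expR (ln u - ln t).
  move=> u0 _; apply: (le_trans (K1le u u0)).
  by rewrite ler_wpM2r ?expR_ge0.
have U := HU f0 _ t s0 CnN tp HKf0 HK0.
have W := HV f1 _ t s1 CnN tp HK1 HKf1.
have cY0 : carrier Y0 f0 by split => //; exact: le_lt_trans U (ltry _).
have cY1 : carrier Y1 f1 by split => //; exact: le_lt_trans W (ltry _).
split; first by rewrite fE; exact: sum_spaceD.
rewrite (rnormE Y0fin cY0) lee_fin powRE// in U.
rewrite (rnormE Y1fin cY1) lee_fin in W.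
set w := c0 t * expR (- theta0 * ln t) in U.
have KYle : KY (rho t) f <= (CU + CV) * (Cn * N1 * w).
  rewrite fE; apply: (le_trans (rK_le Y0fin Y1fin (ltW P0) cY0 cY1)).
  rewrite mulrDl lerD//; apply: (le_trans (ler_wpM2l (ltW P0) W)).
  by rewrite mulrCA (mulrCA (rho t)) rhoE.
have hp : 0 <= expR (- theta * ln (rho t)) * a (rho t).
  by rewrite mulr_ge0 ?expR_ge0// ltW// sa.1.
apply: (le_trans (ler_wpM2l hp KYle)).
have -> : expR (- theta * ln (rho t)) * a (rho t) * ((CU + CV) * (Cn * N1 * w)) =
   (CU + CV) * Cn * N1 * (expR (- theta * ln (rho t)) * a (rho t) * w) by ring.
rewrite -weight_rho// -AtE /N1 le_eqVlt; apply/orP; left; apply/eqP.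
rewrite mulNr expRN; field.
by rewrite !gt_eqF ?expR_gt0.
Qed.

Lemma moderate_phi : exists2 N : R, 0 <= N &
  (forall f, sum_space A0 A1 f -> moderate N (phiA f)) /\
  (forall f, sum_space Y0 Y1 f -> moderate N (phiY f)).
Proof.
have [N N0 HN] := moderate_weight eta sasharp.
have [N' N'0 HN'] := moderate_weight theta sa.
exists (N + N'); first exact: addr_ge0.
split => f sf.
  apply: (@moderate_weaken _ N) => [|u u0|]; first by rewrite lerDl.
    by rewrite mulr_ge0 ?rK_ge0 ?(ltW u0)// mulr_ge0 ?expR_ge0// ltW// (sasharp.1 u).
  apply: HN => [u u0|]; first by rewrite rK_ge0// ltW.
  exact: rK_moderate.
apply: (@moderate_weaken _ N') => [|u u0|]; first by rewrite lerDr.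
  by rewrite mulr_ge0 ?rK_ge0 ?(ltW u0)// mulr_ge0 ?expR_ge0// ltW// sa.1.
apply: HN' => [u u0|]; first by rewrite rK_ge0// ltW.
exact: rK_moderate.
Qed.

Let phiA_ge0 f u : 0 < u -> 0 <= phiA f u.
Proof.
move=> u0; rewrite mulr_ge0 ?rK_ge0 ?(ltW u0)// mulr_ge0 ?expR_ge0// ltW//.
exact: (sasharp.1 u).
Qed.

Let phiY_ge0 f u : 0 < u -> 0 <= phiY f u.
Proof.
by move=> u0; rewrite mulr_ge0 ?rK_ge0 ?(ltW u0)// mulr_ge0 ?expR_ge0// ltW// sa.1.
Qed.

(** [Lq_transfer] with sigma = rho, separated by [rho_separated]. Its hypothesis is read only at u =
    rho(t), where the exponential is 1, so delta = 1 is an arbitrary choice. *)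
Lemma reiteration_sub :
  embedded (interpK Y0 Y1 theta r a) (interpK A0 A1 eta r asharp).
Proof.
have [N N0 [mA mY]] := moderate_phi.
have [C C0 HC] := phiA_le_phiY.
have [c Hc] := rho_separated m0 sg.
have [C' C'0 HT] := Lq_transfer hr N0 ltr01 (divr_gt0 m0 (ltr0Sn R 1)) C0 Hc.
have main f : sum_space Y0 Y1 f -> (interpK_norm A0 A1 eta r asharp f <=
    C'%:E * interpK_norm Y0 Y1 theta r a f)%E.
  move=> sf; have sfA := sumY_sumA sf.
  rewrite (interpK_normE A0fin A1fin)// (interpK_normE Y0fin Y1fin)//.
  apply: HT => //; [exact: phiA_ge0|exact: phiY_ge0|exact: mA|exact: mY|].
  move=> t B t0 B0 hB; apply: (le_trans (HC f t sf t0)); rewrite ler_wpM2l ?(ltW C0)//.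
  have P0 := rho0 t0; apply: (le_trans (hB _ P0)).
  by rewrite subrr normr0 mulr0 expR0 mulr1.
split; last by exists C' => // f [sf _]; exact: main.
move=> f [sf fin]; split; first exact: sumY_sumA.
apply: (le_lt_trans (main f sf)).
by apply: lte_mul_pinfty => //; rewrite ?lee_fin ?(ltW C'0).
Qed.

(** [Lq_transfer] with the quasi-inverse sigma, whose separation comes from the upper bound on the
    increments of rho. Since rho(sigma t) equals t only up to a factor, moderation of phiY brings
    the estimate back to t, at the cost of exp(N * (1 + c)). *)
Lemma reiteration_sup :
  embedded (interpK A0 A1 eta r asharp) (interpK Y0 Y1 theta r a).
Proof.
have [N N0 [mA mY]] := moderate_phi.
have [delta [C [d0 C0 HC]]] := phiY_le_phiA.
have [sigma [c Hs]] := rho_inverse m0 sg.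
have [cu Hu] := rho_upper m0 sg.
have m20 : 0 < 2 * (1 - theta0) by rewrite mulr_gt0.
have sep s t : 0 < s -> 0 < t -> (2 * (1 - theta0))^-1 * `|ln s - ln t|
    - (2 * (1 - theta0))^-1 * (2 * c + cu) <= `|ln (sigma s) - ln (sigma t)|.
  move=> s0 t0; have [ss0 hs] := Hs s s0; have [st0 ht] := Hs t t0.
  rewrite -mulrBr ler_pdivrMl//.
  have h1 := Hu _ _ ss0 st0.
  have h2 := ler_distD (ln (rho (sigma s))) (ln s) (ln t).
  have h3 := ler_distD (ln (rho (sigma t))) (ln (rho (sigma s))) (ln t).
  rewrite (distrC (ln s) (ln (rho (sigma s)))) in h2.
  by lra.
have [Cp Cp0 Hp] := Lq_ge_pointwise hr N0.
have CN0 : 0 < C * expR (N * (1 + c)) by rewrite mulr_gt0 ?expR_gt0.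
have iv0 : 0 < (2 * (1 - theta0))^-1 by rewrite invr_gt0.
have [C' C'0 HT] := Lq_transfer hr N0 d0 iv0 CN0 sep.
(* A finite norm bounds phiA pointwise, so the splitting at the single point t = 1 already places f
   in Y0 + Y1; the added 1 makes B positive. *)
have sumY f : carrier (interpK A0 A1 eta r asharp) f -> sum_space Y0 Y1 f.
  move=> [sf fin]; rewrite (interpK_normE A0fin A1fin)// in fin.
  set L := Lq _ _ _ in fin.
  have Lfin : L \is a fin_num by rewrite ge0_fin_numE// Lq_ge0.
  have B0 : 0 < Cp * fine L + 1 by rewrite ltr_wpDl// mulr_ge0 ?fine_ge0 ?Lq_ge0 ?(ltW Cp0).
  apply: (HC f 1 (Cp * fine L + 1) sf ltr01 B0 _).1 => u u0.
  have := Hp _ (fun v v0 => @phiA_ge0 f v v0) (mA f sf) u u0.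
  rewrite -/L -(fineK Lfin) -EFinM lee_fin => h; apply: (le_trans h).
  apply: (@le_trans _ _ (Cp * fine L + 1)); first by rewrite lerDl.
  by rewrite ler_peMr ?(ltW B0)// -[leLHS]expR0 ler_expR mulr_ge0// ltW.
have main f : carrier (interpK A0 A1 eta r asharp) f ->
    (interpK_norm Y0 Y1 theta r a f <= C'%:E * interpK_norm A0 A1 eta r asharp f)%E.
  move=> cf; have sfY := sumY f cf; have sf := cf.1.
  rewrite (interpK_normE A0fin A1fin)// (interpK_normE Y0fin Y1fin)//.
  apply: HT => //; [exact: phiY_ge0|exact: phiA_ge0|exact: mY|exact: mA|].
  move=> t B t0 B0 hB; have [st0 ht] := Hs t t0.
  have [_ h] := HC f _ B sf st0 B0 hB.
  have P0 := rho0 st0.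
  apply: (le_trans (mY f sfY t _ t0 P0)).
  apply: (@le_trans _ _ (C * B * expR (N * (1 + `|ln t - ln (rho (sigma t))|)))).
    by rewrite ler_wpM2r ?expR_ge0.
  rewrite mulrAC ler_wpM2r ?(ltW B0)// ler_wpM2l ?(ltW C0)// ler_expR.
  by rewrite ler_wpM2l// lerD2l distrC.
split; last by exists C' => // f; exact: main.
move=> f cf; split; first exact: sumY.
apply: (le_lt_trans (main f cf)).
by apply: lte_mul_pinfty; rewrite ?lee_fin ?(ltW C'0)//; exact: cf.2.
Qed.

End Reiteration.

Unset Implicit Arguments.
Set Strict Implicit.

Theorem theorem12 (R : realType) (V : topologicalLmodType R)
    (A0 A1 : @qspace R V) (theta theta0 : R) (q0 r0 r1 r : \bar R)
    (a a0 b0 b1 : R -> R)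
    (hA : compatible_couple A0 A1)
    (hA01 : exists2 f : V, carrier A0 f /\ carrier A1 f & f <> 0)
    (htheta : 0 < theta < 1) (htheta0 : 0 < theta0 < 1)
    (hq0 : (0 < q0)%E) (hr0 : (0 < r0)%E) (hr1 : (0 < r1)%E) (hr : (0 < r)%E)
    (ha : SV a) (ha0 : SV a0) (hb0 : SV b0) (hb1 : SV b1)
    (hfin0 : (Lq r0 `]1%R, +oo[
       (fun s => (s `^ (- recip r0) * (b0 s / a0 s))%:E) < +oo)%E)
    (hfin1 : (Lq r1 `]0%R, 1%R[
       (fun s => (s `^ (- recip r1) * b1 s)%:E) < +oo)%E) :
  let c0 := fun t : R => a0 t *
    fine (Lq r0 `]t, +oo[
      (fun s => (s `^ (- recip r0) * (b0 s / a0 s))%:E)) in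
  let c1 := fun t : R =>
    fine (Lq r1 `]0, t[ (fun s => (s `^ (- recip r1) * b1 s)%:E)) in
  let rho := fun t : R => t `^ (1 - theta0) * (c0 t / c1 t) in
  let eta : R := (1 - theta) * theta0 + theta in
  let asharp := fun t : R =>
    c0 t `^ (1 - theta) * c1 t `^ theta * a (rho t) in
  same_space
    (interpK (interpL A0 A1 theta0 r0 b0 q0 a0) (interpK A0 A1 1 r1 b1)
       theta r a)
    (interpK A0 A1 eta r asharp).
Proof.
move=> c0 c1 rho eta asharp.
have [_ hA0 hA1 _ _] := hA.
have sa := SV_slow ha; have sa0 := SV_slow ha0.
have sb0 := SV_slow hb0; have sb1 := SV_slow hb1.
have [_ mb1 _] := hb1.
have mh0 := measurable_SV_div hb0 ha0.
split.
  exact: (reiteration_sub theta hA0 hA1 htheta0 hq0 hr0 hr1 hr sa sa0 sb0 sb1 mh0 mb1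
    hfin0 hfin1).
exact: (reiteration_sup hA0 hA1 htheta htheta0 hq0 hr0 hr1 hr sa sa0 sb0 sb1 mh0 mb1
  hfin0 hfin1).
Qed.
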